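(* Let $q$ be an odd prime power, and let $D$ be a derivation set on the line at infinity $\ell_\infty$ of $\mathrm{AG}(2,q^2)$. Let $K$ be a parabola whose infinite point does not belong to $D$. Then there are exactly $a_3=(q^2-1)/2$ lines of $\mathrm{Hall}(q^2)$ meeting $K$ in exactly $3$ (affine) points, and exactly $a_4=(q-3)(q^2-1)/24$ lines of $\mathrm{Hall}(q^2)$ meeting $K$ in exactly $4$ (affine) points.
   Context: $\mathrm{AG}(2,q^2)=\mathrm{PG}(2,q^2)\setminus\ell_\infty$. A derivation set $D$ is a Baer subline of $\ell_\infty$, i.e. an image under a projectivity of $\ell_\infty$ of the standard one $\{(x:y:0)\mid x,y\in\mathrm{GF}(q),\ (x,y)\neq(0,0)\}$ (where $\ell_\infty: Z=0$). The affine Hall plane $\mathrm{Hall}(q^2)$ obtained from $D$ has as points the points of $\mathrm{AG}(2,q^2)$; its lines are the ''old lines'', i.e. the affine parts of the lines of $\mathrm{PG}(2,q^2)$ other than $\ell_\infty$ whose infinite point is not in $D$, and the ''new lines'', i.e. the affine parts $B\setminus\ell_\infty$ of the Baer subplanes $B$ (subplanes of order $q$) of $\mathrm{PG}(2,q^2)$ containing $D$. For the standard $D$ the new lines are the sets $\{(a+\lambda u,b+\lambda v): u,v\in\mathrm{GF}(q)\}$ with $a,b\in\mathrm{GF}(q^2)$, $\lambda\in\mathrm{GF}(q^2)^*$. Conic means irreducible conic. A parabola is a conic of $\mathrm{PG}(2,q^2)$ having exactly one point on $\ell_\infty$ (its infinite point). *)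

(* Defs.v *)
From mathcomp Require Import all_boot all_order all_algebra.
From mathcomp Require Import mpoly.

Set Implicit Arguments.
Unset Strict Implicit.
Unset Printing Implicit Defensive.

Import GRing.Theory.
Local Open Scope ring_scope.

(* Points and lines of PG(2, F) are the subspaces of F^3 of dimension 1 and 2.
   A subspace is represented by its canonical matrix: <<A>>%MS depends only on
   the row space of A, so Leibniz equality is equality of subspaces. *)
Definition is_subspace (F : finFieldType) (d : nat) (A : 'M[F]_3) : bool :=
  (<<A>>%MS == A) && (\rank A == d).

Notation ppoint F := {A : 'M[F]_3 | is_subspace 1 A}.
Notation pline F := {A : 'M[F]_3 | is_subspace 2 A}.

Definition points_of (F : finFieldType) (l : pline F) : {set ppoint F} :=
  [set P : ppoint F | (val P <= val l)%MS].

(* Homogeneous coordinates are (x : y : z); the line at infinity is z = 0. *)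
Definition linf (F : finFieldType) : {set ppoint F} :=
  [set P : ppoint F | col ord_max (val P) == 0].

(* When #|F| = q ^ 2, this is the subfield GF(q) of F. *)
Definition subGF (F : finFieldType) (q : nat) : {set F} :=
  [set x : F | x ^+ q == x].

(* The image of the standard Baer subline of z = 0 under the projectivity
   (x : y : 0) |-> ((x, y) M : 0). *)
Definition baer_subline (F : finFieldType) (q : nat) (M : 'M[F]_2) :
    {set ppoint F} :=
  [set P : ppoint F | [exists v : 'rV[F]_2,
     [&& v != 0, [forall i, v 0 i \in subGF F q]
       & (val P == row_mx (v *m M) (0 : 'rV[F]_1))%MS]]].

Definition derivation_set (F : finFieldType) (q : nat) (D : {set ppoint F}) :
    Prop :=
  exists2 M : 'M[F]_2, M \in unitmx & D = baer_subline q M.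

(* A set B of points, with the lines of PG(2, F) joining two of its points, is
   a projective plane of order n: two lines meet in B, there is a quadrangle,
   and every line carries n + 1 points. The remaining axiom, that two points lie
   on exactly one line, is inherited from PG(2, F). *)
Definition subplane (F : finFieldType) (n : nat) (B : {set ppoint F}) : bool :=
  let lines := [set l : pline F | (1 < #|B :&: points_of l|)%N] in
  [&& [forall l in lines, forall m in lines,
         (l != m) ==> [exists P in B, P \in points_of l :&: points_of m]],
      [exists Q : {set ppoint F}, [&& Q \subset B, #|Q| == 4%N
         & [forall l : pline F, (#|Q :&: points_of l| <= 2)%N]]]
    & [forall l in lines, #|B :&: points_of l| == n.+1]].

(* Points of the affine planes are the points of PG(2, F) off linf; affine
   lines are the corresponding sets of points. *)
Definition old_lines (F : finFieldType) (D : {set ppoint F}) :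
    {set {set ppoint F}} :=
  [set points_of l :\: linf F | l : pline F
     & (points_of l != linf F)
       && [forall P in points_of l :&: linf F, P \notin D]].

Definition new_lines (F : finFieldType) (q : nat) (D : {set ppoint F}) :
    {set {set ppoint F}} :=
  [set B :\: linf F | B : {set ppoint F} & subplane q B && (D \subset B)].

Definition hall_lines (F : finFieldType) (q : nat) (D : {set ppoint F}) :
    {set {set ppoint F}} :=
  old_lines D :|: new_lines q D.

Definition irreducible_elt (R : idomainType) (p : R) : Prop :=
  [/\ p != 0, p \isn't a GRing.unit
    & forall a b : R, p = a * b -> a \is a GRing.unit \/ b \is a GRing.unit].

(* Irreducibility of a conic is geometric: irreducibility over F alone would
   also admit a pair of conjugate lines over the quadratic extension of F. *)
Definition abs_irreducible (F : fieldType) (p : {mpoly F[3]}) : Prop :=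
  forall (L : fieldType) (f : {rmorphism F -> L}),
    irreducible_elt (map_mpoly f p).

Definition zeros (F : finFieldType) (p : {mpoly F[3]}) : {set ppoint F} :=
  [set P : ppoint F | [forall v : 'rV[F]_3,
     (v <= val P)%MS ==> (p.@[fun i => v 0 i] == 0)]].

Definition conic (F : finFieldType) (K : {set ppoint F}) : Prop :=
  exists p : {mpoly F[3]},
    [/\ p \is 2.-homog, abs_irreducible p & K = zeros p].

Definition parabola (F : finFieldType) (K : {set ppoint F}) : Prop :=
  conic K /\ #|K :&: linf F| = 1%N.

(* Main.v *)
Require Import Defs.
From mathcomp Require Import all_boot all_order all_algebra all_field.
From mathcomp Require Import mpoly ring.

Set Implicit Arguments.
Unset Strict Implicit.
Unset Printing Implicit Defensive.

Import GRing.Theory.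
Local Open Scope ring_scope.
(** Write N(u) = u^(q+1) for the norm of GF(q^2) over GF(q). Affine coordinates
    (x, y) can be chosen in which D consists of the directions of slope d with
    N(d) = 1 and the infinite point of K is the direction of the x-axis: take
    as basis at infinity a vector spanning the infinite point of K and its
    conjugate with respect to D, two vectors that are independent because that
    point is not in D ([baer_subline_frame], [parabola_frame]). Then K becomes
    x = g(y) for a quadratic polynomial g with leading coefficient al
    ([parabola_equation]), and the new lines become the sets y^q = mu x + c
    with N(mu) = 1 ([subplane_baer], [subplane_eq_baer]). An old line meets K
    at most twice, so the theorem counts the equations t^q = mu g(t) + c with
    exactly three or four roots t.

    Let r, s, t be parameters of points of K and let a, b, c be the values of
    al (u + v) + be on the pairs (s,t), (r,t), (r,s), where be is the linear
    coefficient of g; they are the inverse slopes of the chords of K. If the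
    three points are distinct and on a common new line, then a, b and c have
    norm 1 and mu is determined by mu a b c al^q = -al ([hits_triple]).
    Conversely, if a, b, c have norm 1 then a^q = 1/a and likewise for b and c,
    and this alone forces the three points onto a common new line
    ([line_paramsP]). As q is odd, (r,s,t) can be recovered from (a,b,c). So
    the ordered triples of distinct points of K on a new line correspond to
    the ordered triples of distinct elements of the group of norm 1, which has
    order q + 1.

    A new line through three points of K passes through one further candidate
    only, the point whose chords to the three have the inverse slopes -a, -b
    and -c ([hits_fourth]). It coincides with one of the three exactly when two
    of a, b, c are opposite ([card_hits]). A line with three points thus
    accounts for 6 triples (a,b,c) with an opposite pair, of which there are
    3 (q+1)(q-1), and a line with four points for 24 triples without one, of
    which there are (q+1)(q-1)(q-3). *)
(** * Power maps of finite fields and ordered triples *)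

Lemma card_units_gt0 (F : finFieldType) : (0 < #|F|.-1)%N.
Proof. by rewrite -subn1 subn_gt0 finRing_gt1. Qed.

Lemma finField_prim_root (F : finFieldType) :
  exists g : F, #|F|.-1.-primitive_root g.
Proof.
have /hasP[g _ hg] : has (#|F|.-1).-primitive_root (enum [pred x : F | x != 0]).
  apply: cyclic.has_prim_root (card_units_gt0 F) _ (enum_uniq _) _.
  - apply/allP => x; rewrite mem_enum inE => x0.
    apply/unity_rootP; apply: (mulfI x0).
    by rewrite -exprS prednK ?expf_card ?mulr1 // ltnW // finRing_gt1.
  - by rewrite -cardE cardC1.
by exists g.
Qed.

(** The units form a cyclic group of order n k, so its k-th roots of unity are
    exactly the n-th powers, and every fibre of x |-> x^n over them is a coset
    of the group of n-th roots of unity. Both Hilbert 90 and the number of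
    elements of norm 1 are instances. *)
Lemma card_pow_fiber (F : finFieldType) (n k : nat) (y : F) :
  (n * k)%N = #|F|.-1 -> y ^+ k = 1 -> #|[set x : F | x ^+ n == y]| = n.
Proof.
move=> hnk hy; have [g hg] := finField_prim_root F.
have c0 := card_units_gt0 F.
have n0 : (0 < n)%N by move: c0; rewrite -hnk muln_gt0 => /andP[].
have k0 : (0 < k)%N by move: c0; rewrite -hnk muln_gt0 => /andP[].
have y0 : y != 0.
  apply: contra_eq_neq hy => ->.
  by rewrite expr0n eqn0Ngt k0 eq_sym oner_neq0.
have yc : y ^+ #|F|.-1 = 1 by rewrite -hnk mulnC exprM hy expr1n.
have [[i /= _] yi] := prim_rootP hg yc.
have /dvdnP[j ij] : (n %| i)%N.
  move: hy; rewrite yi -exprM => /eqP; rewrite -(prim_order_dvd hg) -hnk.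
  by rewrite dvdn_pmul2r.
have hz : n.-primitive_root (g ^+ k).
  by have := exp_prim_root hg k; rewrite -hnk gcdnMl mulnK.
pose f (l : 'I_n) := g ^+ j * (g ^+ k) ^+ l.
have gj0 : g ^+ j != 0.
  apply: contraNneq y0; rewrite yi ij exprM => ->.
  by rewrite expr0n eqn0Ngt n0.
have finj : injective f.
  move=> a b /(mulfI gj0) /eqP; rewrite (eq_prim_root_expr hz).
  by rewrite !modn_small // => /eqP/val_inj.
rewrite -[RHS]card_ord -(card_imset _ finj).
apply: eq_card => x; rewrite !inE; apply/eqP/imsetP.
  move=> hx; have : (x / g ^+ j) ^+ n = 1.
    by rewrite expr_div_n hx -(exprM g j) -ij -yi divff.
  by case/(prim_rootP hz) => l hl; exists l => //; rewrite /f -hl mulrC divfK.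
case=> l _ ->; rewrite exprMn -(exprM g j) -ij -yi (exprAC (g ^+ k)).
by rewrite (prim_expr_order hz) expr1n mulr1.
Qed.

Lemma card_triples (T1 T2 T3 : finType) (A : {pred T1}) (B : T1 -> {pred T2})
    (C : T1 -> T2 -> {pred T3}) (n1 n2 n3 : nat) :
  #|A| = n1 -> (forall a, a \in A -> #|B a| = n2) ->
  (forall a b, a \in A -> b \in B a -> #|C a b| = n3) ->
  #|[set x : T1 * T2 * T3 | [&& x.1.1 \in A, x.1.2 \in B x.1.1
       & x.2 \in C x.1.1 x.1.2]]| = (n1 * n2 * n3)%N.
Proof.
move=> hA hB hC; rewrite -sum1_card.
transitivity (\sum_(a in A) \sum_(b in B a) \sum_(c in C a b) 1)%N.
  rewrite pair_big_dep /= pair_big_dep /=.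
  by apply: eq_bigl => -[[a b] c]; rewrite !inE /= andbA.
rewrite (eq_bigr (fun=> (n2 * n3)%N)); first by rewrite sum_nat_const hA mulnA.
move=> a ha; rewrite (eq_bigr (fun=> n3)); first by rewrite sum_nat_const hB.
by move=> b hb; rewrite sum1_card hC.
Qed.

(** The shape is that of [card_triples]: each entry ranges over a set that
    depends on the previous ones. *)
Definition dtriples (T : finType) (A : {set T}) : {set T * T * T} :=
  [set x : T * T * T | [&& x.1.1 \in A, x.1.2 \in A :\ x.1.1
       & x.2 \in A :\ x.1.1 :\ x.1.2]].

Lemma card_dtriples (T : finType) (A : {set T}) :
  #|dtriples A| = (#|A| * #|A|.-1 * #|A|.-2)%N.
Proof.
apply: (card_triples (A := mem A) (B := fun a => mem (A :\ a))
  (C := fun a b => mem (A :\ a :\ b))) => //.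
  by move=> a ha; rewrite [#|A|](cardsD1 a) ha.
move=> a b /= ha hb; rewrite [#|A|](cardsD1 a) ha /= [#|A :\ a|](cardsD1 b).
by rewrite hb.
Qed.

Lemma dtriplesE (T : finType) (A : {set T}) (r s t : T) :
  ((r, s, t) \in dtriples A) =
  [&& r \in A, s \in A & t \in A] && [&& r != s, r != t & s != t].
Proof.
rewrite !inE /= (eq_sym s) (eq_sym t s) (eq_sym t r).
by do 3!case: (_ \in A); do 3!case: (_ == _).
Qed.

(** * Points and lines in coordinates *)

Section Coordinates.

Variable F : finFieldType.

Definition vec3 (x y w : F) : 'rV[F]_3 := \row_j [:: x; y; w]`_j.

Lemma vec3_surj (v : 'rV[F]_3) : exists x y w, v = vec3 x y w.
Proof.
exists (v 0 0), (v 0 1), (v 0 ord_max); apply/rowP => -[[|[|[|//]]] hj];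
  by rewrite mxE /=; congr (v _ _); apply: val_inj.
Qed.

Lemma vec3_inj x y w x' y' w' :
  vec3 x y w = vec3 x' y' w' -> [/\ x = x', y = y' & w = w'].
Proof.
by move=> /rowP h; have := h 0; have := h 1; have := h ord_max; rewrite !mxE.
Qed.

Lemma vec3Z k x y w : k *: vec3 x y w = vec3 (k * x) (k * y) (k * w).
Proof. by apply/rowP => -[[|[|[|//]]] hj]; rewrite !mxE. Qed.

Lemma vec3_0 : 0 = vec3 0 0 0.
Proof. by apply/rowP => -[[|[|[|//]]] hj]; rewrite !mxE. Qed.

Lemma vec3_eq0 x y w : (vec3 x y w == 0) = [&& x == 0, y == 0 & w == 0].
Proof.
rewrite [0 in LHS]vec3_0; apply/eqP/and3P => [/vec3_inj[-> -> ->]|[]]; first by [].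
by do 3!move/eqP->.
Qed.

Lemma vec3_dot x y w (u : 'cV[F]_3) :
  (vec3 x y w *m u == 0) = (u 0 0 * x + u 1 0 * y + u ord_max 0 * w == 0).
Proof.
have -> : (vec3 x y w *m u == 0) = ((vec3 x y w *m u) 0 0 == 0).
  apply/eqP/eqP => [->|h]; first by rewrite mxE.
  by apply/matrixP => i j; rewrite !ord1 h mxE.
rewrite mxE !big_ord_recl big_ord0 !mxE /= addr0 addrA ![u _ _ * _]mulrC.
by congr (_ * u _ _ + _ * u _ _ + _ * u _ _ == 0); apply: val_inj.
Qed.

Lemma col3_surj (u : 'cV[F]_3) : u != 0 ->
  exists a b c, [/\ ~~ [&& a == 0, b == 0 & c == 0],
    a = u 0 0, b = u 1 0 & c = u ord_max 0].
Proof.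
move=> u0; exists (u 0 0), (u 1 0), (u ord_max 0); split=> //.
apply: contra u0 => /and3P[/eqP a0 /eqP b0 /eqP c0]; apply/eqP/colP.
case=> [[|[|[|//]]] hj]; rewrite mxE.
- by rewrite -[RHS]a0; congr (u _ _); apply: val_inj.
- by rewrite -[RHS]b0; congr (u _ _); apply: val_inj.
- by rewrite -[RHS]c0; congr (u _ _); apply: val_inj.
Qed.

Lemma subspace_genmx (m d : nat) (A : 'M[F]_(m, 3)) :
  \rank A = d -> is_subspace d <<A>>%MS.
Proof. by move=> rA; rewrite /is_subspace genmx_id eqxx genmxE rA eqxx. Qed.

(** The default point is a junk value, taken only at v = 0. *)
Definition span_point (v : 'rV[F]_3) : ppoint F :=
  insubd (exist (is_subspace 1) <<delta_mx 0 0 : 'rV[F]_3>>%MS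
            (subspace_genmx (mxrank_delta F 0 0))) <<v>>%MS.

Lemma val_span_point v : v != 0 -> val (span_point v) = <<v>>%MS.
Proof.
by move=> v0; rewrite insubdK //; apply: subspace_genmx; rewrite rank_rV v0.
Qed.

Lemma span_point_surj (P : ppoint F) : exists2 v, v != 0 & P = span_point v.
Proof.
have /andP[/eqP gP /eqP rP] := valP P.
have v0 : nz_row (val P) != 0 by rewrite nz_row_eq0 -mxrank_eq0 rP.
exists (nz_row (val P)) => //; apply: val_inj; rewrite val_span_point //.
rewrite -[LHS]gP; apply/genmxP; rewrite andbC -mxrank_leqif_eq ?nz_row_sub //.
by rewrite rP rank_rV v0.
Qed.

Lemma span_point_eq v v' : v != 0 -> v' != 0 -> span_point v = span_point v' ->
  exists2 k, k != 0 & v = k *: v'.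
Proof.
move=> v0 v'0 /(congr1 val); rewrite !val_span_point // => /genmxP/andP[/sub_rVP[k hk] _].
exists k => //; by apply: contraNneq v0 => k0; rewrite hk k0 scale0r.
Qed.

Lemma span_pointZ k v : k != 0 -> span_point (k *: v) = span_point v.
Proof.
move=> k0; rewrite /span_point; congr insubd.
by apply/genmxP; rewrite !eqmx_scale // submx_refl.
Qed.

Lemma points_of_span v (l : pline F) : v != 0 ->
  (span_point v \in points_of l) = (v <= val l)%MS.
Proof. by move=> v0; rewrite inE val_span_point // genmxE. Qed.

Lemma linf_span v : v != 0 -> (span_point v \in linf F) = (v 0 ord_max == 0).
Proof.
move=> v0; rewrite inE val_span_point // colE.
have -> : (<<v>>%MS *m delta_mx ord_max 0 == 0 :> 'cV_3) =
  (v *m delta_mx ord_max 0 == 0 :> 'cV_1) by rewrite !(sameP eqP sub_kermxP) genmxE.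
rewrite -colE; apply/eqP/eqP => [/colP/(_ 0)|h]; first by rewrite !mxE.
by apply/colP => i; rewrite ord1 !mxE.
Qed.

(** The coefficients of an equation of l span the kernel of the transpose of l,
    which has dimension 3 - 2 = 1. *)
Lemma pline_ker (l : pline F) : exists2 u : 'cV[F]_3, u != 0 &
  forall v : 'rV[F]_3, (v <= val l)%MS = (v *m u == 0).
Proof.
have /andP[_ /eqP rl] := valP l.
pose w := nz_row (kermx (val l)^T).
have w0 : w != 0 by rewrite nz_row_eq0 -mxrank_eq0 mxrank_ker mxrank_tr rl.
have lw : val l *m w^T = 0.
  apply: trmx_inj; rewrite trmx_mul trmxK trmx0.
  by apply/sub_kermxP; apply: nz_row_sub.
exists w^T => [|v]; first by rewrite trmx_eq0.
rewrite (sameP eqP sub_kermxP).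
have e : (val l == kermx w^T)%MS.
  rewrite -mxrank_leqif_eq; last exact/sub_kermxP.
  by rewrite mxrank_ker mxrank_tr rank_rV w0 rl.
by rewrite (eqmxP e).
Qed.

Lemma ker_pline (u : 'cV[F]_3) : u != 0 -> exists l : pline F,
  forall v : 'rV[F]_3, (v <= val l)%MS = (v *m u == 0).
Proof.
move=> u0.
have hr : \rank (kermx u) = 2%N.
  by rewrite mxrank_ker -mxrank_tr rank_rV trmx_eq0 u0.
exists (exist (is_subspace 2) <<kermx u>>%MS (subspace_genmx hr)) => v /=.
by rewrite genmxE (sameP eqP sub_kermxP).
Qed.

Lemma rank_join (P Q : ppoint F) : P != Q -> \rank (val P + val Q)%MS = 2%N.
Proof.
have /andP[/eqP gP /eqP rP] := valP P; have /andP[/eqP gQ /eqP rQ] := valP Q.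
move=> PQ; apply/eqP; rewrite eqn_leq; apply/andP; split.
  by rewrite (leq_trans (mxrank_adds_leqif _ _)) // rP rQ.
rewrite ltnNge; apply: contra PQ => h.
have eP : (val P == val P + val Q)%MS.
  rewrite -mxrank_leqif_eq ?addsmxSl // eqn_leq mxrankS ?addsmxSl //=.
  by rewrite rP.
have eQ : (val Q == val P + val Q)%MS.
  rewrite -mxrank_leqif_eq ?addsmxSr // eqn_leq mxrankS ?addsmxSr //=.
  by rewrite rQ.
apply/eqP/val_inj; rewrite -[LHS]gP -[RHS]gQ; apply/genmxP.
exact/eqmxP/(eqmx_trans (eqmxP eP) (eqmx_sym (eqmxP eQ))).
Qed.

Lemma line_exists (P Q : ppoint F) : P != Q ->
  exists l : pline F, P \in points_of l /\ Q \in points_of l.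
Proof.
move=> PQ; exists (exist (is_subspace 2) _ (subspace_genmx (rank_join PQ))).
by rewrite !inE /= !genmxE addsmxSl addsmxSr.
Qed.

Lemma line_unique (P Q : ppoint F) (l m : pline F) : P != Q ->
  P \in points_of l -> Q \in points_of l ->
  P \in points_of m -> Q \in points_of m -> l = m.
Proof.
move=> PQ; rewrite !inE => Pl Ql Pm Qm; apply: val_inj.
have join (k : pline F) : (val P <= val k)%MS -> (val Q <= val k)%MS ->
    val k = <<(val P + val Q)%MS>>%MS.
  have /andP[/eqP gk /eqP rk] := valP k.
  move=> Pk Qk; rewrite -[LHS]gk; apply/genmxP.
  have h : (val P + val Q <= val k)%MS by rewrite addsmx_sub Pk.
  by rewrite andbC -(mxrank_leqif_eq h) rank_join // rk.
by rewrite (join l Pl Ql) (join m Pm Qm).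
Qed.

Section Frame.

Variable N : 'M[F]_3.
Hypothesis N_unit : N \in unitmx.
Hypothesis N_aff : col ord_max N = delta_mx ord_max 0.

(** The rows of N are the vectors of the reference frame; the hypothesis on
    its last column puts the first two on the line at infinity and normalizes
    the third. *)
Definition hpoint (x y w : F) : ppoint F := span_point (vec3 x y w *m N).

Lemma vec3N_neq0 x y w :
  (vec3 x y w *m N != 0) = ~~ [&& x == 0, y == 0 & w == 0].
Proof. by rewrite -(mul0mx _ N) (inj_eq (can_inj (mulmxK N_unit))) vec3_eq0. Qed.

Lemma hpoint_surj P : exists x y w, ~~ [&& x == 0, y == 0 & w == 0] /\ P = hpoint x y w.
Proof.
have [v v0 ->] := span_point_surj P.
have [x [y [w e]]] := vec3_surj (v *m invmx N).
have e' : v = vec3 x y w *m N by rewrite -e mulmxKV.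
by exists x, y, w; rewrite -vec3N_neq0 -e'; split=> //; rewrite /hpoint -e'.
Qed.

Lemma hpoint_eq x y w x' y' w' :
  ~~ [&& x == 0, y == 0 & w == 0] -> ~~ [&& x' == 0, y' == 0 & w' == 0] ->
  hpoint x y w = hpoint x' y' w' ->
  exists2 k, k != 0 & [/\ x = k * x', y = k * y' & w = k * w'].
Proof.
rewrite -!vec3N_neq0 => v0 v'0 /(span_point_eq v0 v'0)[k k0].
rewrite scalemxAl => /(can_inj (mulmxK N_unit)); rewrite vec3Z => /vec3_inj.
by exists k.
Qed.

Lemma hpointZ k x y w : k != 0 -> hpoint (k * x) (k * y) (k * w) = hpoint x y w.
Proof. by move=> k0; rewrite /hpoint -vec3Z -scalemxAl span_pointZ. Qed.

Lemma hpoint_linf x y w : ~~ [&& x == 0, y == 0 & w == 0] ->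
  (hpoint x y w \in linf F) = (w == 0).
Proof.
rewrite -vec3N_neq0 => v0; rewrite linf_span //.
have -> : (vec3 x y w *m N) 0 ord_max = w; last by [].
transitivity (col ord_max (vec3 x y w *m N) 0 0); first by rewrite [RHS]mxE.
by rewrite colE -mulmxA -colE N_aff -colE !mxE.
Qed.

Lemma line_equation (l : pline F) : exists a b c,
  ~~ [&& a == 0, b == 0 & c == 0] /\
  forall x y w, ~~ [&& x == 0, y == 0 & w == 0] ->
    (hpoint x y w \in points_of l) = (a * x + b * y + c * w == 0).
Proof.
have [u u0 hu] := pline_ker l.
have Nu0 : N *m u != 0.
  by rewrite -(mulmx0 _ N) (inj_eq (can_inj (mulKmx N_unit))).
have [a [b [c [abc ea eb ec]]]] := col3_surj Nu0.
exists a, b, c; split=> // x y w v0.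
by rewrite points_of_span ?vec3N_neq0 // hu -mulmxA vec3_dot ea eb ec.
Qed.

Lemma equation_line a b c : ~~ [&& a == 0, b == 0 & c == 0] ->
  exists l : pline F, forall x y w, ~~ [&& x == 0, y == 0 & w == 0] ->
    (hpoint x y w \in points_of l) = (a * x + b * y + c * w == 0).
Proof.
move=> abc; pose u := invmx N *m (vec3 a b c)^T.
have u0 : u != 0.
  rewrite -(mulmx0 _ (invmx N)) (inj_eq (can_inj (mulKVmx N_unit))) trmx_eq0.
  by rewrite vec3_eq0.
have [l hl] := ker_pline u0; exists l => x y w v0.
rewrite points_of_span ?vec3N_neq0 // hl mulmxA mulmxK // vec3_dot.
by rewrite !mxE.
Qed.

Definition aff (x y : F) : ppoint F := hpoint x y 1.
(** The infinite point of the lines of slope d, in the frame N. *)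
Definition inf (d : F) : ppoint F := hpoint 1 d 0.

Let aff0 (x y : F) : ~~ [&& x == 0, y == 0 & 1 == 0 :> F].
Proof. by rewrite oner_eq0 !andbF. Qed.

Let inf0 (d : F) : ~~ [&& 1 == 0 :> F, d == 0 & 0 == 0 :> F].
Proof. by rewrite oner_eq0. Qed.

Lemma aff_inj x y x' y' : aff x y = aff x' y' -> x = x' /\ y = y'.
Proof.
move/(hpoint_eq (aff0 x y) (aff0 x' y')) => [k _ []] -> ->.
by rewrite mulr1 => <-; rewrite !mul1r.
Qed.

Lemma inf_inj : injective inf.
Proof.
move=> d d' /(hpoint_eq (inf0 d) (inf0 d'))[k _ []]; rewrite mulr1 => <- -> _.
by rewrite mul1r.
Qed.

Lemma aff_linf x y : aff x y \notin linf F.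
Proof. by rewrite (hpoint_linf (aff0 x y)) oner_eq0. Qed.

Lemma inf_linf d : inf d \in linf F.
Proof. by rewrite (hpoint_linf (inf0 d)). Qed.

Lemma aff_neq_inf x y d : aff x y != inf d.
Proof. by apply: contraNneq (aff_linf x y) => ->; apply: inf_linf. Qed.

Lemma aff_surj P : P \notin linf F -> exists x y, P = aff x y.
Proof.
have [x [y [w [h ->]]]] := hpoint_surj P; rewrite hpoint_linf // => w0.
exists (w^-1 * x), (w^-1 * y); rewrite /aff -(mulVf w0).
by rewrite hpointZ // invr_eq0.
Qed.

Lemma linf_line : exists l : pline F, points_of l = linf F.
Proof.
have [|l hl] := @equation_line 0 0 1; first by rewrite oner_eq0 !andbF.
exists l; apply/setP => P; have [x [y [w [h ->]]]] := hpoint_surj P.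
by rewrite hl // hpoint_linf // !mul0r mul1r !add0r.
Qed.

Lemma line_linf (l : pline F) P Q : P != Q -> P \in points_of l ->
  Q \in points_of l -> P \in linf F -> Q \in linf F -> points_of l = linf F.
Proof.
have [m <-] := linf_line => PQ Pl Ql Pm Qm.
by rewrite (line_unique PQ Pl Ql Pm Qm).
Qed.

Lemma line_affine (l : pline F) x0 y0 : aff x0 y0 \in points_of l ->
  exists a b, [/\ ~~ ((a == 0) && (b == 0)),
    forall x y, (aff x y \in points_of l) = (a * (x - x0) + b * (y - y0) == 0)
  & forall d, (inf d \in points_of l) = (a + b * d == 0)].
Proof.
have [a [b [c [abc hl]]]] := line_equation l.
rewrite hl // mulr1 => /eqP e0; exists a, b; split=> [|x y|d].
- apply: contra abc => /andP[/eqP a0 /eqP b0].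
  by move: e0; rewrite a0 b0 !mul0r !add0r => ->; rewrite !eqxx.
- have ec : c = - (a * x0 + b * y0) by apply/eqP; rewrite -addr_eq0 addrC e0.
  by rewrite hl // ec; congr (_ == 0); ring.
- by rewrite hl // mulr1 mulr0 addr0.
Qed.

Lemma line_slope (l : pline F) x0 y0 d :
    aff x0 y0 \in points_of l -> inf d \in points_of l ->
  (forall x y, (aff x y \in points_of l) = (y - y0 == d * (x - x0))) /\
  (forall d', (inf d' \in points_of l) = (d' == d)).
Proof.
move=> /line_affine[a [b [ab ha hi]]]; rewrite hi addrC addr_eq0 => /eqP e.
have b0 : b != 0.
  apply: contra ab => /eqP b0; move: e; rewrite b0 mul0r eqxx andbT.
  by move/esym/eqP; rewrite oppr_eq0.
have ea : a = - (b * d) by rewrite e opprK.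
split=> [x y|d']; rewrite ?ha ?hi ea.
  rewrite -[RHS]subr_eq0 -[RHS](mulrI_eq0 _ (mulfI b0)); congr (_ == 0); ring.
by rewrite -[RHS]subr_eq0 -[RHS](mulrI_eq0 _ (mulfI b0)); congr (_ == 0); ring.
Qed.

Lemma line_chord (l : pline F) x0 y0 x1 y1 : x1 != x0 ->
  aff x0 y0 \in points_of l -> aff x1 y1 \in points_of l ->
  inf ((y1 - y0) / (x1 - x0)) \in points_of l.
Proof.
move=> ne /line_affine[a [b [ab ha hi]]]; rewrite ha hi => /eqP e.
have ne0 : x1 - x0 != 0 by rewrite subr_eq0.
rewrite -(mulIr_eq0 _ (mulIf ne0)) mulrDl -mulrA divfK //.
by rewrite e.
Qed.

End Frame.

End Coordinates.

(** * The equation of a parabola *)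

Section QuadraticForms.

Variable R : comNzRingType.

Definition qform (A B C D E G : R) (x y z : R) : R :=
  A * x ^+ 2 + B * x * y + C * y ^+ 2 + D * x * z + E * y * z + G * z ^+ 2.

Definition quad (al be ga t : R) : R := al * t ^+ 2 + be * t + ga.

End QuadraticForms.

Section TernaryForms.

Variable F : fieldType.

(** Linear forms are kept as coefficient vectors because an extension of
    scalars is then visibly again a form vanishing at the origin. *)
Definition linform (u : 'cV[F]_3) : {mpoly F[3]} :=
  \sum_i (u i 0)%:MP_[3] * 'X_i.

Lemma meval_linform u (v : 'rV[F]_3) :
  (linform u).@[fun i => v 0 i] = (v *m u) 0 0.
Proof.
rewrite /linform rmorph_sum /= mxE; apply: eq_bigr => i _.
by rewrite mevalM mevalC mevalXU mulrC.
Qed.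

Lemma meval_map_linform (L : fieldType) (f : {rmorphism F -> L}) u :
  (map_mpoly f (linform u)).@[fun=> 0] = 0.
Proof.
have -> : map_mpoly f (linform u) = \sum_i (f (u i 0))%:MP_[3] * 'X_i.
  rewrite raddf_sum /=; apply: eq_bigr => i _.
  by rewrite rmorphM /= map_mpolyC map_mpolyX.
rewrite rmorph_sum /= big1 // => i _.
by rewrite mevalM mevalXU mulr0.
Qed.

Variables (l0 l1 l2 : {mpoly F[3]}).

Let comb (p : {mpoly F[3]}) := exists a b c : F,
  p = a%:MP * l0 + b%:MP * l1 + c%:MP * l2.

Let quadratic (p : {mpoly F[3]}) := exists A B C D E G : F,
  p = qform A%:MP B%:MP C%:MP D%:MP E%:MP G%:MP l0 l1 l2.

(** A monomial of degree 2 is a product of two variables, and a product of two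
    combinations of l0, l1, l2 is a quadratic form in them. *)
Lemma dhomog2_qform (p : {mpoly F[3]}) : (forall i, comb 'X_i) ->
  p \is 2.-homog -> quadratic p.
Proof.
move=> hX /dhomogP hp; rewrite [p]mpolyE big_seq.
apply: (big_ind quadratic) => [|x y|m /hp /= hm].
- by exists 0, 0, 0, 0, 0, 0; rewrite /qform mpolyC0; ring.
- move=> [A [B [C [D [E [G ->]]]]]] [A' [B' [C' [D' [E' [G' ->]]]]]].
  exists (A + A'), (B + B'), (C + C'), (D + D'), (E + E'), (G + G').
  by rewrite /qform !mpolyCD; ring.
(* Split m as a product of two variables. *)
have [i mi] : exists i, m i != 0%N.
  apply/existsP; rewrite -negb_forall; apply: contra_eqN hm => /forallP h.
  by rewrite mdegE big1 // => i _; apply/eqP.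
have em : (m = (m - U_(i)) + U_(i))%MM.
  rewrite submK //; apply/mnm_lepP => j; rewrite mnm1E.
  by case: eqP => // <-; rewrite lt0n.
have /mdeg1P[j /eqP ej] : mdeg (m - U_(i))%MM == 1%N.
  by move: hm; rewrite em mdegD mdeg1 addn1 -em => -[->].
rewrite em ej mpolyXD -mul_mpolyC.
have [a [b [c ->]]] := hX i; have [a' [b' [c' ->]]] := hX j.
exists (p@_m * (a * a')), (p@_m * (a * b' + a' * b)), (p@_m * (b * b')),
  (p@_m * (a * c' + a' * c)), (p@_m * (b * c' + b' * c)), (p@_m * (c * c')).
by rewrite -ej -em /qform !(mpolyCM, mpolyCD); ring.
Qed.

End TernaryForms.

Section ConicCoordinates.

Variable F : finFieldType.

(** A quadratic form in only two linear forms l1, l2 splits into linear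
    factors over an algebraic closure. This is where irreducibility over
    extensions of F is needed: over F such a form may be a pair of conjugate
    lines. *)
Lemma abs_irreducible_qform (p : {mpoly F[3]}) (C E G : F) u1 u2 u0 :
    abs_irreducible p -> C != 0 ->
  p != qform 0 0 C%:MP 0 E%:MP G%:MP (linform u0) (linform u1) (linform u2).
Proof.
move=> irr C0; apply/eqP => ep.
have [L [f _]] := closed_field.countable_algebraic_closure F.
have fC0 : f C != 0 by rewrite fmorph_eq0.
(* r is a root of C X^2 + E X + G, and s below is the other one. *)
have [r hr] := @solve_monicpoly L 2 (nth 0 [:: - (f G / f C); - (f E / f C)]) isT.
rewrite !big_ord_recl big_ord0 /= expr0 mulr1 addr0 expr1 in hr.
pose y := map_mpoly f (linform u1); pose z := map_mpoly f (linform u2).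
pose s := - (r + f E / f C).
have fac : map_mpoly f p =
    ((f C)%:MP * (y - r%:MP * z)) * (y - s%:MP * z).
  rewrite ep /qform !(rmorphD, rmorphM, rmorphXn, rmorph0) /= !map_mpolyC /= -/y -/z.
  have eE : f E = - (f C) * (r + s) by rewrite /s; field.
  have eG : f G = f C * (r * s).
    have e : r ^+ 2 = - (f G / f C) - f E / f C * r by rewrite hr; ring.
    by rewrite /s mulrN mulrDr -expr2 e; field.
  by rewrite eE eG !(mpolyCM, mpolyCD, mpolyCN); ring.
(* Both factors vanish at the origin, where a unit would not. *)
have nonunit (t : L) : (y - t%:MP * z).@[fun=> 0] = 0.
  by rewrite mevalB mevalM !meval_map_linform mulr0 subrr.
have [_ _ /(_ _ _ fac)] := irr L f.
have absurd (a : {mpoly L[3]}) : a.@[fun=> 0] = 0 -> a \isn't a GRing.unit.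
  move=> a0; apply/negP => /(rmorph_unit (meval (fun=> 0 : L))) /=.
  by rewrite a0 unitr0.
by case; apply/negP; rewrite absurd // mevalM ?nonunit ?mulr0.
Qed.

(** The linear forms are the coordinate functions of the frame N, that is, the
    columns of the inverse of N. *)
Lemma qform_frame (N : 'M[F]_3) (p : {mpoly F[3]}) :
    N \in unitmx -> p \is 2.-homog ->
  exists A B C D E G u0 u1 u2,
    p = qform A%:MP B%:MP C%:MP D%:MP E%:MP G%:MP
          (linform u0) (linform u1) (linform u2)
    /\ forall x y w, p.@[fun i => (vec3 x y w *m N) 0 i] = qform A B C D E G x y w.
Proof.
move=> N_unit hp.
pose u k := col k (invmx N).
have hX i : 'X_i = \sum_k (N k i)%:MP_[3] * linform (u k).
  rewrite /linform; under eq_bigr do rewrite big_distrr /=.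
  rewrite exchange_big /= (bigD1 i) //= [X in _ + X]big1 ?addr0 => [|j ji].
    transitivity (((invmx N *m N) i i)%:MP_[3] * 'X_i).
      by rewrite mulVmx // mxE eqxx mul1r.
    rewrite mxE rmorph_sum mulr_suml; apply: eq_bigr => k _ /=.
    by rewrite mxE mulrC mpolyCM; ring.
  transitivity (((invmx N *m N) j i)%:MP_[3] * 'X_j).
    rewrite mxE rmorph_sum mulr_suml; apply: eq_bigr => k _ /=.
    by rewrite mxE mpolyCM; ring.
  by rewrite mulVmx // mxE (negPf ji) mpolyC0 mul0r.
have [|A [B [C [D [E [G ep]]]]]] := @dhomog2_qform F (linform (u ord0))
  (linform (u (lift ord0 ord0))) (linform (u (lift ord0 (lift ord0 ord0)))) p _ hp.
  move=> i; rewrite hX !big_ord_recl big_ord0 addr0 addrA.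
  by eexists; eexists; eexists.
exists A, B, C, D, E, G; do 3!eexists; split; first exact: ep.
move=> x y w.
have ev k : (linform (u k)).@[fun i => (vec3 x y w *m N) 0 i] = vec3 x y w 0 k.
  by rewrite meval_linform /u colE mulmxA mulmxK // -colE mxE.
rewrite ep /qform !(mevalD, mevalM, mevalC, rmorphXn) /= !ev !mxE /=.
by rewrite !expr2.
Qed.

(** Put w = 0 in the equation A x^2 + B x y + C y^2 + D x w + E y w + G w^2 = 0
    of K: having (1 : 0 : 0) as only solution forces A = B = 0 and C nonzero.
    Absolute irreducibility then gives D nonzero, and for w = 1 the equation
    can be solved for x. *)
Lemma parabola_equation (N : 'M[F]_3) (K : {set ppoint F}) :
    N \in unitmx -> col ord_max N = delta_mx ord_max 0 ->
    conic K -> K :&: linf F = [set inf N 0] ->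
  exists al be ga, al != 0 /\
    forall x y, (aff N x y \in K) = (x == quad al be ga y).
Proof.
move=> N_unit N_aff [p [hp irr eK]] Kinf.
have [A [B [C [D [E [G [u0 [u1 [u2 [ep ev]]]]]]]]]] := qform_frame N_unit hp.
have on x y w : ~~ [&& x == 0, y == 0 & w == 0] ->
    (hpoint N x y w \in K) = (qform A B C D E G x y w == 0).
  move=> h; have v0 : vec3 x y w *m N != 0 by rewrite (vec3N_neq0 N_unit).
  rewrite eK inE val_span_point //; apply/forallP/eqP => [/(_ (vec3 x y w *m N))|e v].
    by rewrite genmxE submx_refl /= ev => /eqP.
  apply/implyP; rewrite genmxE => /sub_rVP[k ->].
  rewrite scalemxAl vec3Z ev.
  have -> : qform A B C D E G (k * x) (k * y) (k * w) =
    k ^+ 2 * qform A B C D E G x y w by rewrite /qform; ring.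
  by rewrite e mulr0.
have onlyinf x y : ~~ ((x == 0) && (y == 0)) ->
    qform A B C D E G x y 0 = 0 -> y = 0.
  move=> xy e; have h : ~~ [&& x == 0, y == 0 & (0 : F) == 0] by rewrite eqxx andbT.
  have : hpoint N x y 0 \in K :&: linf F by rewrite in_setI on // e hpoint_linf // !eqxx.
  rewrite Kinf in_set1 => /eqP /(hpoint_eq N_unit h).
  by case=> [|k _ [_ -> _]]; rewrite ?oner_eq0 // mulr0.
have A0 : A = 0.
  have : hpoint N 1 0 0 \in K.
    by have : inf N 0 \in K :&: linf F by [rewrite Kinf set11]; rewrite in_setI => /andP[].
  rewrite on ?oner_eq0 // /qform => /eqP e; rewrite -[RHS]e; ring.
have B0 : B = 0.
  apply/eqP/negPn/negP => B0.
  have : B = 0; last by move/eqP; rewrite (negPf B0).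
  (* If B were nonzero, (-C : B : 0) would be a second infinite point of K. *)
  apply: (onlyinf (- C)); first by rewrite (negPf B0) andbF.
  by rewrite /qform A0; ring.
have C0 : C != 0.
  apply/eqP => C0; have /eqP : (1 : F) = 0; last by rewrite oner_eq0.
  (* If C were zero, (0 : 1 : 0) would be a second infinite point of K. *)
  apply: (onlyinf 0); first by rewrite oner_eq0 andbF.
  by rewrite /qform A0 B0 C0; ring.
have D0 : D != 0.
  apply/eqP => D0; have := abs_irreducible_qform E G u1 u2 u0 irr C0.
  by rewrite ep A0 B0 D0 mpolyC0 eqxx.
exists (- (C / D)), (- (E / D)), (- (G / D)); split=> [|x y].
  by rewrite oppr_eq0 mulf_neq0 ?invr_eq0.
rewrite on ?oner_eq0 ?andbF // -[RHS]subr_eq0 -[RHS](mulrI_eq0 _ (mulfI D0)).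
by congr (_ == 0); rewrite /qform /quad A0 B0; field.
Qed.

End ConicCoordinates.

(** * Elements of norm 1 *)

Section QuadraticExtension.

Variables (F : finFieldType) (q : nat).
Hypothesis cardF : #|F| = (q ^ 2)%N.
Hypothesis q_gt2 : (2 < q)%N.
Hypothesis frobD : forall x y : F, (x + y) ^+ q = x ^+ q + y ^+ q.
Hypothesis two_neq0 : 2 != 0 :> F.

Definition norm1 : {set F} := [set u : F | u ^+ q.+1 == 1].

Lemma frobK (x : F) : (x ^+ q) ^+ q = x.
Proof. by rewrite -exprM mulnn -cardF expf_card. Qed.

Lemma q_gt0 : (0 < q)%N.
Proof. by case: q q_gt2. Qed.

Lemma frob0 : 0 ^+ q = 0 :> F.
Proof. by rewrite expr0n eqn0Ngt q_gt0. Qed.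

Lemma frobN (x : F) : (- x) ^+ q = - x ^+ q.
Proof. by apply/eqP; rewrite -subr_eq0 opprK -frobD addNr frob0. Qed.

Lemma frobB (x y : F) : (x - y) ^+ q = x ^+ q - y ^+ q.
Proof. by rewrite frobD frobN. Qed.

Lemma card_units_factor : (q.+1 * q.-1)%N = #|F|.-1.
Proof. by have := subn_sqr q 1; rewrite exp1n !subn1 addn1 cardF mulnC => ->. Qed.

Lemma card_norm1 : #|norm1| = q.+1.
Proof.
apply: card_pow_fiber card_units_factor _; exact: expr1n.
Qed.

Lemma norm1_neq0 u : u \in norm1 -> u != 0.
Proof.
by rewrite inE; apply: contraTneq => ->; rewrite exprS mul0r eq_sym oner_neq0.
Qed.

Lemma norm1P u : reflect (u != 0 /\ u ^+ q = u^-1) (u \in norm1).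
Proof.
apply: (iffP idP) => [hu|[u0 hu]]; last by rewrite inE exprS hu divff.
have u0 := norm1_neq0 hu; split=> //; apply: (mulfI u0).
by rewrite divff // -exprS; move: hu; rewrite inE => /eqP.
Qed.

(** On elements of norm 1 the Frobenius map is inversion; this turns the
    equations of new lines into rational ones. *)
Lemma norm1_frob u : u \in norm1 -> u ^+ q = u^-1.
Proof. by case/norm1P. Qed.

Lemma norm1N u : u \in norm1 -> - u \in norm1.
Proof.
by case/norm1P=> u0 hu; apply/norm1P; rewrite oppr_eq0 frobN hu invrN.
Qed.

Lemma norm1M u v : u \in norm1 -> v \in norm1 -> u * v \in norm1.
Proof. by rewrite !inE exprMn => /eqP-> /eqP->; rewrite mulr1. Qed.

Lemma norm1V u : u \in norm1 -> u^-1 \in norm1.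
Proof. by rewrite !inE exprVn => /eqP->; rewrite invr1. Qed.

Lemma norm1_1 : 1 \in norm1.
Proof. by rewrite inE expr1n. Qed.

Lemma norm1_frob_div x : x != 0 -> x ^+ q / x \in norm1.
Proof.
move=> x0; apply/norm1P; rewrite mulf_neq0 ?invr_eq0 ?expf_neq0 //; split=> //.
by rewrite exprMn frobK exprVn invfM invrK mulrC.
Qed.

(** This is Hilbert 90: for z nonzero the equation says that z^(q-1) = u, and
    the (q-1)-st powers are the elements of norm 1. *)
Lemma card_hilbert90 u : u \in norm1 ->
  #|[set z : F | (z != 0) && (z ^+ q == u * z)]| = q.-1.
Proof.
move=> hu; have u0 := norm1_neq0 hu.
rewrite -[RHS](@card_pow_fiber F q.-1 q.+1 u); first 1 last.
- by rewrite mulnC card_units_factor.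
- by apply/eqP; rewrite inE in hu.
apply: eq_card => z; rewrite !inE; have [->|z0] /= := eqVneq z 0.
  rewrite expr0n; case: q q_gt2 => [|[|n]] //= _; apply/esym/eqP => h.
  by rewrite -h eqxx in u0.
by rewrite -{1}(prednK q_gt0) exprSr (inj_eq (mulIf z0)).
Qed.

(** * Roots of t^q = mu g(t) + c *)

Section Chords.

Variables al be ga : F.
Hypothesis al0 : al != 0.

Local Notation g := (quad al be ga).

(** For distinct s and t this is the inverse slope (g s - g t) / (s - t) of the
    chord of x = g(y) through the points with parameters s and t; for s = t it
    is that of the tangent. *)
Definition slope (s t : F) : F := al * (s + t) + be.

(** The parameters t for which the point (g t, t) is on the set
    y^q = mu x + c. *)
Definition hits (mu c : F) : {set F} := [set t : F | t ^+ q == mu * g t + c].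

Lemma slopeC s t : slope s t = slope t s.
Proof. by rewrite /slope (addrC s). Qed.

Lemma quadB s t : g s - g t = (s - t) * slope s t.
Proof. by rewrite /quad /slope; ring. Qed.

Lemma hits_chord mu c s t : s \in hits mu c ->
  (t \in hits mu c) = ((s - t) ^+ q == mu * ((s - t) * slope s t)).
Proof.
rewrite !inE -quadB frobB => /eqP->; rewrite mulrBr.
by rewrite -subr_eq0 -oppr_eq0 -[in RHS]subr_eq0; congr (_ == 0); ring.
Qed.

(** Dividing (s - t)^q = mu (s - t) slope s t by s - t shows that mu times the
    slope is a (q-1)-st power. *)
Lemma hits_slope mu c s t : mu \in norm1 -> s \in hits mu c -> t \in hits mu c ->
  s != t -> slope s t \in norm1.
Proof.
move=> hmu hs; rewrite (hits_chord t hs) => /eqP hst ne.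
have st0 : s - t != 0 by rewrite subr_eq0.
have -> : slope s t = mu^-1 * ((s - t) ^+ q / (s - t)).
  by rewrite hst; field; rewrite st0 (norm1_neq0 hmu).
by rewrite norm1M ?norm1V ?norm1_frob_div.
Qed.

(** Since al (s - t) is the difference of the slopes of the chords rs and rt,
    two elements on which the q-th power is inversion, its q-th power is a
    difference of inverses. No new line enters here, which is what makes the
    converse [line_paramsP] possible. *)
Lemma frob_chord r s t : slope r s \in norm1 -> slope r t \in norm1 ->
  al ^+ q * (s - t) ^+ q * (slope r s * slope r t) = - al * (s - t).
Proof.
move=> hc hb; have c0 := norm1_neq0 hc; have b0 := norm1_neq0 hb.
have e : al * (s - t) = slope r s - slope r t by rewrite /slope; ring.
rewrite -exprMn mulNr e frobB (norm1_frob hc) (norm1_frob hb).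
by rewrite -{3 4}[slope]/slope; field; rewrite b0 c0.
Qed.

Lemma hits_triple mu c r s t : mu \in norm1 ->
    r \in hits mu c -> s \in hits mu c -> t \in hits mu c ->
    r != s -> r != t -> s != t ->
  mu * (slope s t * slope r t * slope r s) * al ^+ q = - al.
Proof.
move=> hmu hr hs ht rs rt st.
have hc := hits_slope hmu hr hs rs; have hb := hits_slope hmu hr ht rt.
have st0 : s - t != 0 by rewrite subr_eq0.
apply: (mulIf st0); rewrite -(frob_chord hc hb).
by move: ht; rewrite (hits_chord t hs) => /eqP->; ring.
Qed.

Lemma al_norm1 : al / al ^+ q \in norm1.
Proof. by rewrite -invf_div norm1V // norm1_frob_div. Qed.

(** The only candidate for a new line through three given points: mu is solved
    from [hits_triple] and c from the condition at r. *)
Definition line_params (x : F * F * F) : F * F :=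
  let: (r, s, t) := x in
  let mu := - (al / al ^+ q) / (slope s t * slope r t * slope r s) in
  (mu, r ^+ q - mu * g r).

Arguments line_params : simpl never.

(** The parameter mu is symmetric in r, s, t, and [frob_chord] turns the
    condition on each of the pairs (r,s) and (r,t) into its definition. *)
Lemma line_paramsP r s t : slope s t \in norm1 -> slope r t \in norm1 ->
    slope r s \in norm1 ->
  let y := line_params (r, s, t) in
  [/\ y.1 \in norm1, r \in hits y.1 y.2, s \in hits y.1 y.2 & t \in hits y.1 y.2].
Proof.
move=> ha hb hc; rewrite /line_params /=; set mu := - _ / _; set c := _ - _.
have a0 := norm1_neq0 ha; have b0 := norm1_neq0 hb; have c0 := norm1_neq0 hc.
have alq0 : al ^+ q != 0 by rewrite expf_neq0.
have hr : r \in hits mu c by rewrite inE addrC subrK.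
split=> //.
- by rewrite norm1M ?norm1N ?al_norm1 // norm1V // !norm1M.
- rewrite (hits_chord s hr); apply/eqP.
  have := @frob_chord t r s; rewrite !(slopeC t) => /(_ hb ha) e.
  apply: (mulfI alq0); apply: (mulIf (mulf_neq0 b0 a0)); rewrite e /mu.
  by field; rewrite a0 b0 c0 alq0.
- rewrite (hits_chord t hr); apply/eqP.
  have := @frob_chord s r t; rewrite !(slopeC s r) => /(_ hc ha) e.
  apply: (mulfI alq0); apply: (mulIf (mulf_neq0 c0 a0)); rewrite e /mu.
  by field; rewrite a0 b0 c0 alq0.
Qed.

Lemma line_params_unique mu c r s t : mu \in norm1 ->
    r \in hits mu c -> s \in hits mu c -> t \in hits mu c ->
    r != s -> r != t -> s != t -> line_params (r, s, t) = (mu, c).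
Proof.
move=> hmu hr hs ht rs rt st.
have ha := hits_slope hmu hs ht st; have hb := hits_slope hmu hr ht rt.
have hc := hits_slope hmu hr hs rs.
have a0 := norm1_neq0 ha; have b0 := norm1_neq0 hb; have c0 := norm1_neq0 hc.
have alq0 : al ^+ q != 0 by rewrite expf_neq0.
rewrite /line_params; have -> : - (al / al ^+ q) / (slope s t * slope r t * slope r s) = mu.
  rewrite -mulNr -(hits_triple hmu hr hs ht rs rt st).
  by field; rewrite a0 b0 c0 alq0.
by move: hr; rewrite inE => /eqP->; rewrite addrAC subrr add0r.
Qed.

(** The solution d of slope r d = - slope s t; by symmetry it also satisfies
    slope s d = - slope r t and slope t d = - slope r s. *)
Definition fourth (r s t : F) : F := - (r + s + t) - 2 * be / al.

(** The slopes from d to r and s are opposite to known elements of norm 1,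
    hence of norm 1, and the product of the three slopes of the triple (r,s,d)
    equals that of (r,s,t), so d is a root. Any other root u has by
    [hits_triple] the same product of slopes with r and s as t does, a
    quadratic condition on u with the solutions t and d only. *)
Lemma hits_fourth mu c r s t : mu \in norm1 ->
    r \in hits mu c -> s \in hits mu c -> t \in hits mu c ->
    r != s -> r != t -> s != t ->
  hits mu c = [set r; s; t; fourth r s t].
Proof.
move=> hmu hr hs ht rs rt st; set d := fourth r s t.
have e := hits_triple hmu hr hs ht rs rt st.
have ha := hits_slope hmu hs ht st; have hb := hits_slope hmu hr ht rt.
have hc := hits_slope hmu hr hs rs.
have a0 := norm1_neq0 ha; have b0 := norm1_neq0 hb; have c0 := norm1_neq0 hc.
have alq0 : al ^+ q != 0 by rewrite expf_neq0.
have hd : d \in hits mu c.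
  have dr : slope r d = - slope s t by rewrite /slope /d /fourth; field.
  have ds : slope s d = - slope r t by rewrite /slope /d /fourth; field.
  rewrite (hits_chord d hr) dr; apply/eqP.
  have := @frob_chord s r d; rewrite slopeC ds => /(_ hc (norm1N hb)) h.
  apply: (mulfI alq0); apply: (mulIf (mulf_neq0 c0 b0)).
  apply: oppr_inj; rewrite -mulrN -mulrN h -e; ring.
apply/eqP; rewrite eq_sym eqEsubset; apply/andP; split.
  by rewrite !subUset !sub1set hr hs ht hd.
apply/subsetP => u hu; rewrite !inE -!orbA.
have [//|ur] := eqVneq u r; have [//|us] := eqVneq u s.
have [//|ut] := eqVneq u t; rewrite /=.
have e' : mu * (slope s u * slope r u * slope r s) * al ^+ q = - al.
  by apply: hits_triple hmu hr hs hu rs _ _; rewrite eq_sym.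
have mu0 := norm1_neq0 hmu.
have : slope s u * slope r u = slope s t * slope r t.
  apply: (mulIf c0); apply: (mulfI mu0); apply: (mulIf alq0).
  by rewrite e e'.
move/eqP; rewrite -subr_eq0.
have -> : slope s u * slope r u - slope s t * slope r t
   = al * (u - t) * (al * (u - d)).
  by rewrite /slope /d /fourth; field.
by rewrite !mulf_eq0 !subr_eq0 (negPf al0) (negPf ut).
Qed.

Lemma fourth_eq r s t : (fourth r s t == r) = (slope r s + slope r t == 0).
Proof.
have e : slope r s + slope r t = - al * (fourth r s t - r).
  by rewrite /slope /fourth; field.
by rewrite e mulf_eq0 oppr_eq0 (negPf al0) subr_eq0.
Qed.

Lemma fourthC r s t : fourth r s t = fourth s r t.
Proof. by rewrite /fourth (addrC r). Qed.

Lemma fourthAC r s t : fourth r s t = fourth t r s.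
Proof. by rewrite /fourth (addrC _ t) addrA. Qed.

Lemma card_hits mu c r s t : mu \in norm1 ->
    r \in hits mu c -> s \in hits mu c -> t \in hits mu c ->
    r != s -> r != t -> s != t ->
  #|hits mu c| = (3 + [&& slope r s + slope r t != 0,
    slope s t + slope r s != 0 & slope s t + slope r t != 0]%R)%N.
Proof.
move=> hmu hr hs ht rs rt st; rewrite (hits_fourth hmu hr hs ht rs rt st).
have -> : [set r; s; t; fourth r s t] = fourth r s t |: (t |: [set r; s]).
  by rewrite setUC (setUC [set t]).
rewrite !cardsU1 cards1 !inE !negb_or rs (eq_sym t r) (eq_sym t s) rt st /=.
rewrite addnC; congr (_ + _)%N; congr nat_of_bool.
rewrite [X in X != t](fourthAC r s t) [X in X != s](fourthC r s t) !fourth_eq.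
rewrite !(slopeC t) (slopeC s r) andbC -andbA.
by rewrite (addrC (slope r t) (slope s t)) (addrC (slope r s) (slope s t)).
Qed.

Definition chord_slopes (x : F * F * F) : F * F * F :=
  let: (r, s, t) := x in (slope s t, slope r t, slope r s).

(** The entry r is recovered from 2 al r + be = slope r t + slope r s - slope s t;
    this needs 2 to be invertible. *)
Lemma chord_slopes_inj : injective chord_slopes.
Proof.
move=> [[r s] t] [[r' s'] t'] [] ha hb hc.
have e (u v w : F) : 2 * al * u = slope u w + slope u v - slope v w - be.
  by rewrite /slope; ring.
have al2 : 2 * al != 0 by rewrite mulf_neq0.
congr (_, _, _); apply: (mulfI al2).
- by rewrite (e r s t) (e r' s' t') ha hb hc.
- by rewrite (e s r t) (e s' r' t') !(slopeC s r) !(slopeC s' r') ha hb hc.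
- by rewrite (e t r s) (e t' r' s') !(slopeC t) !(slopeC t') ha hb hc.
Qed.

Lemma chord_slopes_dtriples r s t : (chord_slopes (r, s, t) \in dtriples norm1) =
  [&& slope s t \in norm1, slope r t \in norm1 & slope r s \in norm1] &&
  [&& r != s, r != t & s != t].
Proof.
have e (u v w : F) : (slope u w == slope v w) = (u == v).
  by rewrite /slope (inj_eq (addIr _)) (inj_eq (mulfI al0)) (inj_eq (addIr _)).
have e1 : (slope s t == slope r s) = (r == t) by rewrite slopeC e eq_sym.
have e2 : (slope r t == slope r s) = (s == t) by rewrite !(slopeC r) e eq_sym.
by rewrite /chord_slopes dtriplesE e e1 e2 (eq_sym s r).
Qed.

(** The parameters (mu, c) of the new lines with exactly k points on the
    parabola x = g(y). *)
Definition secants (k : nat) : {set F * F} :=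
  [set y : F * F | (y.1 \in norm1) && (#|hits y.1 y.2| == k)].

Definition chord_triples (k : nat) : {set F * F * F} :=
  [set x | (chord_slopes x \in dtriples norm1)
           && (#|hits (line_params x).1 (line_params x).2| == k)].

Lemma in_chord_triples k x : (x \in chord_triples k) =
  (chord_slopes x \in dtriples norm1) && (#|hits (line_params x).1 (line_params x).2| == k).
Proof. by rewrite in_set. Qed.

(** Each of these lines has k (k-1) (k-2) ordered triples of distinct roots,
    and every triple of distinct parameters whose slopes have norm 1 arises
    from exactly one line. *)
Lemma card_secants k : (#|secants k| * (k * k.-1 * k.-2))%N =
  #|chord_triples k|.
Proof.
rewrite -[RHS]sum1_card (partition_big line_params (mem (secants k))) /=; last first.
  move=> [[r s] t]; rewrite in_chord_triples chord_slopes_dtriples.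
  case/andP => /andP[/and3P[ha hb hc] _] hk; rewrite inE hk andbT.
  by have [] := line_paramsP ha hb hc.
rewrite -sum_nat_const; apply: eq_bigr => -[mu c]; rewrite inE /= => /andP[hmu /eqP hk].
rewrite -{1 2 3}hk -card_dtriples sum1_card; apply: eq_card => -[[r s] t].
rewrite dtriplesE [RHS]inE /= in_chord_triples chord_slopes_dtriples.
apply/andP/andP.
  case=> /and3P[hr hs ht] /and3P[rs rt st].
  rewrite (line_params_unique hmu hr hs ht rs rt st) hk !eqxx rs rt st !andbT.
  by rewrite (hits_slope hmu hs ht) // (hits_slope hmu hr ht) // (hits_slope hmu hr hs).
case=> /andP[/andP[/and3P[ha hb hc] ->] _] /eqP e; split=> //.
by have := line_paramsP ha hb hc; rewrite e => -[_ -> -> ->].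
Qed.

Lemma card_hits_line_params r s t : chord_slopes (r, s, t) \in dtriples norm1 ->
  #|hits (line_params (r, s, t)).1 (line_params (r, s, t)).2| =
  (3 + [&& slope r s + slope r t != 0, slope s t + slope r s != 0
         & slope s t + slope r t != 0]%R)%N.
Proof.
rewrite chord_slopes_dtriples => /andP[/and3P[ha hb hc] /and3P[rs rt st]].
by have [hmu hr hs ht] := line_paramsP ha hb hc; apply: card_hits.
Qed.

Lemma neq_opp (a : F) : a != 0 -> - a != a.
Proof.
by move=> a0; rewrite -subr_eq0 -opprD oppr_eq0 -mulr2n -mulr_natl mulf_neq0.
Qed.

Lemma card_norm1D2 a : a \in norm1 -> #|norm1 :\ a :\ - a| = q.-1.
Proof.
move=> ha; have a0 := norm1_neq0 ha.
have := card_norm1; rewrite (cardsD1 a) ha (cardsD1 (- a)) in_setD1.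
by rewrite norm1N // (neq_opp a0) !add1n => -[<-].
Qed.

(** Excluding a, -a, b and -b one after the other makes the count a product. *)
Definition no_opposite : {set F * F * F} :=
  [set x : F * F * F | [&& x.1.1 \in norm1,
    x.1.2 \in norm1 :\ x.1.1 :\ - x.1.1
    & x.2 \in norm1 :\ x.1.1 :\ - x.1.1 :\ x.1.2 :\ - x.1.2]].

Lemma card_no_opposite : #|no_opposite| = (q.+1 * q.-1 * (q - 3))%N.
Proof.
apply: (card_triples (A := mem norm1) (B := fun a => mem (norm1 :\ a :\ - a))
  (C := fun a b => mem (norm1 :\ a :\ - a :\ b :\ - b))) => //.
- exact: card_norm1.
- exact: card_norm1D2.
move=> a b /= ha; rewrite !in_setD1 => /and3P[bNa ba hb].
have := card_norm1D2 ha; rewrite (cardsD1 b) (cardsD1 (- b)) !in_setD1.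
rewrite bNa ba hb norm1N // (neq_opp (norm1_neq0 hb)) eqr_opp ba eqr_oppLR bNa.
by case: q q_gt2 => [|[|[|n]]] //= _; rewrite !add1n !subSS subn0 => -[].
Qed.

Lemma no_oppositeE a b c : ((a, b, c) \in no_opposite) =
  ((a, b, c) \in dtriples norm1) && [&& c + b != 0, a + c != 0 & a + b != 0].
Proof.
have e (x y : F) : (x == - y) = (y == - x) by rewrite -eqr_oppLR eq_sym.
rewrite dtriplesE in_set /= !in_setD1 !addr_eq0 (e a b) (e a c).
rewrite (eq_sym a b) (eq_sym a c) (eq_sym b c).
by do 3!case: (_ \in norm1); do 6!case: (_ == _).
Qed.

Lemma card_secants4 : (#|secants 4| * 24)%N = (q.+1 * q.-1 * (q - 3))%N.
Proof.
rewrite -card_no_opposite -(card_preimset _ chord_slopes_inj) (card_secants 4).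
apply: eq_card => -[[r s] t]; rewrite in_chord_triples [RHS]in_set no_oppositeE.
by apply: andb_id2l => h; rewrite card_hits_line_params //; case: [&& _, _ & _].
Qed.

(** A new line with at least three points on the parabola has three or four, so
    the triples of the lines with exactly three are what [card_secants4] leaves
    over. *)
Lemma card_secants3 : (#|secants 3| * 6)%N = (q.+1 * q.-1 * 3)%N.
Proof.
have e : (#|secants 3| * 6 + #|secants 4| * 24)%N = (q.+1 * q * q.-1)%N.
  have -> : (q.+1 * q * q.-1 = #|dtriples norm1|)%N by rewrite card_dtriples card_norm1.
  rewrite (card_secants 3) (card_secants 4).
  rewrite -[#|dtriples norm1|](card_preimset _ chord_slopes_inj) -cardsUI.
  rewrite [X in (_ + X)%N]eq_card0 ?addn0; last first.
    move=> x; rewrite in_setI !in_chord_triples.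
    by have [->|_] := eqVneq #|hits (line_params x).1 (line_params x).2| 3%N; rewrite /= ?andbF.
  apply: eq_card => -[[r s] t].
  rewrite in_setU !in_chord_triples [RHS]in_set -andb_orr.
  by apply: andb_idr => h; rewrite card_hits_line_params //; case: [&& _, _ & _].
have {e} : (#|secants 3| * 6 + q.+1 * q.-1 * (q - 3))%N
    = (q.+1 * q.-1 * 3 + q.+1 * q.-1 * (q - 3))%N.
  by rewrite -mulnDr subnKC // [RHS]mulnAC -e card_secants4.
by move/addIn.
Qed.

End Chords.

(** * New lines in coordinates *)

Section BaerSubplanes.

Variable N : 'M[F]_3.
Hypothesis N_unit : N \in unitmx.
Hypothesis N_aff : col ord_max N = delta_mx ord_max 0.

Local Notation aff := (aff N).
Local Notation inf := (inf N).

(** In an adapted frame this is the derivation set. *)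
Definition inf_norm1 : {set ppoint F} := [set inf d | d in norm1].

Definition new_line (mu c : F) : {set ppoint F} :=
  [set aff z.1 z.2 | z in [set z : F * F | z.2 ^+ q == mu * z.1 + c]].

Definition baer (mu c : F) : {set ppoint F} := inf_norm1 :|: new_line mu c.

Lemma mem_inf_norm1 d : (inf d \in inf_norm1) = (d \in norm1).
Proof. by rewrite mem_imset //; apply: inf_inj. Qed.

Lemma aff_inf_norm1 x y : aff x y \notin inf_norm1.
Proof. by apply/imsetP => -[d _ /eqP]; rewrite (negPf (aff_neq_inf _ _ _ _ _)). Qed.

Lemma mem_new_line mu c x y :
  (aff x y \in new_line mu c) = (y ^+ q == mu * x + c).
Proof.
rewrite (mem_imset _ (x, y)) ?inE // => -[x1 y1] [x2 y2] /=.
by case/(aff_inj N_unit) => -> ->.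
Qed.

Lemma inf_new_line mu c d : inf d \notin new_line mu c.
Proof.
apply/imsetP => -[z _ /esym/eqP].
by rewrite (negPf (aff_neq_inf _ _ _ _ _)).
Qed.

Lemma inf_norm1_linf : inf_norm1 \subset linf F.
Proof. by apply/subsetP => _ /imsetP[d _ ->]; apply: inf_linf. Qed.

Lemma mem_baer_aff mu c x y :
  (aff x y \in baer mu c) = (y ^+ q == mu * x + c).
Proof. by rewrite in_setU mem_new_line (negPf (aff_inf_norm1 x y)). Qed.

Lemma mem_baer_inf mu c d : (inf d \in baer mu c) = (d \in norm1).
Proof. by rewrite in_setU mem_inf_norm1 (negPf (inf_new_line mu c d)) orbF. Qed.

Lemma card_inf_norm1 : #|inf_norm1| = q.+1.
Proof. by rewrite card_imset ?card_norm1 //; apply: inf_inj. Qed.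

Lemma card_frob_eigen u : u \in norm1 -> #|[set z : F | z ^+ q == u * z]| = q.
Proof.
move=> hu; rewrite (cardsD1 0) inE frob0 mulr0 eqxx.
rewrite [#|_|](_ : _ = q.-1); first by rewrite add1n prednK ?q_gt0.
by rewrite -(card_hilbert90 hu); apply: eq_card => z; rewrite !inE.
Qed.

(** On the line of slope d through (x0, y0) the points of the new line are those
    at offset (z, d z) with z^q = mu d z. *)
Lemma new_line_cap_line mu c (l : pline F) x0 y0 d : mu \in norm1 ->
    d \in norm1 -> y0 ^+ q = mu * x0 + c ->
    aff x0 y0 \in points_of l -> inf d \in points_of l ->
  #|new_line mu c :&: points_of l| = q.
Proof.
move=> hmu hd h0 hA hI; have [hl _] := line_slope N_unit hA hI.
have d0 := norm1_neq0 hd.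
rewrite -[RHS](card_frob_eigen (norm1M hmu hd)).
pose f z := aff (x0 + z) (y0 + d * z).
have finj : injective f by move=> z z' /(aff_inj N_unit)[/addrI].
rewrite -(card_imset _ finj); apply: eq_card => P; rewrite in_setI.
have key z : ((y0 + d * z) ^+ q == mu * (x0 + z) + c) = (z ^+ q == mu * d * z).
  rewrite frobD h0 exprMn (norm1_frob hd) mulrDr addrAC.
  rewrite (inj_eq (addIr c)) (inj_eq (addrI (mu * x0))).
  by rewrite -(inj_eq (mulfI d0)) mulVKf // mulrA (mulrC d).
apply/andP/imsetP => [[/imsetP[[x y] /=]]|[z]]; rewrite inE /=.
  move=> hxy -> hP; exists (x - x0); last first.
    by move: hP; rewrite hl => /eqP e; rewrite /f -e !subrKC.
  move: hP; rewrite hl => /eqP e.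
  by rewrite inE -key -e !subrKC.
move=> hz ->; rewrite /f mem_new_line key hz hl; split=> //.
by apply/eqP; ring.
Qed.

Lemma baer_cap_line mu c (l : pline F) x0 y0 d : mu \in norm1 ->
    d \in norm1 -> y0 ^+ q = mu * x0 + c ->
    aff x0 y0 \in points_of l -> inf d \in points_of l ->
  #|baer mu c :&: points_of l| = q.+1.
Proof.
move=> hmu hd h0 hA hI; have [_ hl] := line_slope N_unit hA hI.
rewrite setIUl cardsU (new_line_cap_line hmu hd h0 hA hI).
have -> : inf_norm1 :&: points_of l = [set inf d].
  apply/setP => P; rewrite in_setI in_set1; apply/andP/eqP => [[]|->].
    by case/imsetP=> d' _ ->; rewrite hl => /eqP->.
  by rewrite mem_inf_norm1.
rewrite [_ :&: _](_ : _ = set0) ?cards0 ?cards1 ?subn0 //.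
apply/setP => P; rewrite !inE; apply/negP => /and3P[/eqP-> h _].
by rewrite (negPf (inf_new_line mu c d)) in h.
Qed.

Lemma linf_cap_baer mu c : baer mu c :&: linf F = inf_norm1.
Proof.
apply/setP => P; rewrite in_setI in_setU; apply/andP/idP => [[/orP[]//]|h].
  by case/imsetP=> z _ -> h; have := aff_linf N_unit N_aff z.1 z.2; rewrite h.
by rewrite h; split=> //; apply: (subsetP inf_norm1_linf).
Qed.

Lemma baerD_linf mu c : baer mu c :\: linf F = new_line mu c.
Proof.
apply/setP => P; rewrite in_setD in_setU; apply/andP/idP => [[hP /orP[]//]|h].
  by move/(subsetP inf_norm1_linf); rewrite (negPf hP).
rewrite h orbT; split=> //.
by case/imsetP: h => z _ ->; apply: aff_linf.
Qed.

Lemma norm1_neqN1 : (1 : F) != -1.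
Proof. by rewrite eq_sym neq_opp ?oner_eq0. Qed.

Lemma points_linf_unique (l m : pline F) :
  points_of l = linf F -> points_of m = linf F -> l = m.
Proof.
move=> hl hm.
have ne : inf 1 != inf (-1) by rewrite (inj_eq (inf_inj N_unit)) norm1_neqN1.
by apply: (line_unique ne); rewrite ?hl ?hm; apply: inf_linf.
Qed.

Lemma new_line_slope mu c x0 y0 x1 y1 : mu \in norm1 ->
    y0 ^+ q = mu * x0 + c -> y1 ^+ q = mu * x1 + c -> (x1, y1) != (x0, y0) ->
  x1 != x0 /\ (y1 - y0) / (x1 - x0) \in norm1.
Proof.
move=> hmu h0 h1 ne.
have e : (y1 - y0) ^+ q = mu * (x1 - x0) by rewrite frobB h0 h1; ring.
have x10 : x1 != x0.
  apply: contraNneq ne => xx; rewrite xx xpair_eqE eqxx /=.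
  move: e; rewrite xx subrr mulr0 => /eqP; rewrite expf_eq0 => /andP[_].
  by rewrite subr_eq0.
split=> //; set Y := y1 - y0; set X := x1 - x0.
have X0 : X != 0 by rewrite subr_eq0.
have mu0 := norm1_neq0 hmu.
have Y0 : Y != 0.
  by apply: contra_eq_neq e => Y0; rewrite -/Y Y0 frob0 eq_sym mulf_neq0.
have -> : Y / X = mu * (Y ^+ q / Y)^-1.
  by rewrite (e : Y ^+ q = mu * X) -/X; field; rewrite X0 Y0 mu0.
by rewrite norm1M // norm1V // norm1_frob_div.
Qed.

(** The difference of two points of a new line has slope of norm 1, so a line
    with two points in this set meets the line at infinity in [inf_norm1]
    unless it is the line at infinity. *)
Lemma baer_line mu c (l : pline F) : mu \in norm1 ->
    (1 < #|baer mu c :&: points_of l|)%N ->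
  points_of l = linf F \/ exists x0 y0 d,
    [/\ y0 ^+ q = mu * x0 + c, d \in norm1, aff x0 y0 \in points_of l
      & inf d \in points_of l].
Proof.
move=> hmu /card_gt1P[P [Q []]]; rewrite !in_setI.
case/andP=> hP Pl /andP[hQ Ql] PQ.
move: hP hQ; rewrite !in_setU => /orP[] hP /orP[] hQ.
- left; apply: (line_linf N_unit N_aff PQ Pl Ql);
    exact: (subsetP inf_norm1_linf).
- right; case/imsetP: hP => d hd eP; case/imsetP: hQ => -[x y]; rewrite inE /=.
  by move=> /eqP h eQ; exists x, y, d; rewrite -eP -eQ.
- right; case/imsetP: hQ => d hd eQ; case/imsetP: hP => -[x y]; rewrite inE /=.
  by move=> /eqP h eP; exists x, y, d; rewrite -eP -eQ.
- right; case/imsetP: hP => -[x0 y0]; rewrite inE /= => /eqP h0 eP.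
  case/imsetP: hQ => -[x1 y1]; rewrite inE /= => /eqP h1 eQ.
  have ne : (x1, y1) != (x0, y0).
    by apply: contraNneq PQ => -[ex ey]; rewrite eP eQ ex ey.
  have [x10 hd] := new_line_slope hmu h0 h1 ne.
  exists x0, y0, ((y1 - y0) / (x1 - x0)); rewrite -eP; split=> //.
  by apply: (line_chord N_unit) x10 _ _; rewrite -?eP -?eQ.
Qed.

(** The offset u of the intersection point from (x0, y0) solves a linear
    equation over F; taking q-th powers of that equation, with d^q = 1/d and
    Y^q = mu X, gives (d u)^q = mu u, so the point is in the subplane. *)
Lemma baer_meet mu c (l m : pline F) x0 y0 d x1 y1 d' : mu \in norm1 ->
    y0 ^+ q = mu * x0 + c -> d \in norm1 ->
    aff x0 y0 \in points_of l -> inf d \in points_of l ->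
    y1 ^+ q = mu * x1 + c -> d' \in norm1 ->
    aff x1 y1 \in points_of m -> inf d' \in points_of m -> d != d' ->
  exists2 P, P \in baer mu c & P \in points_of l :&: points_of m.
Proof.
move=> hmu h0 hd lA lI h1 hd' mA mI dd'.
have [hl _] := line_slope N_unit lA lI; have [hm _] := line_slope N_unit mA mI.
have mu0 := norm1_neq0 hmu; have d0 := norm1_neq0 hd; have d'0 := norm1_neq0 hd'.
have dd0 : d - d' != 0 by rewrite subr_eq0.
have dd1 : d' - d != 0 by rewrite -opprB oppr_eq0.
have [X ex] : exists X, x1 = x0 + X by exists (x1 - x0); rewrite subrKC.
have [Y ey] : exists Y, y1 = y0 + Y by exists (y1 - y0); rewrite subrKC.
pose u := (Y - d' * X) / (d - d').
have eY : Y ^+ q = mu * X.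
  by apply: (addrI (y0 ^+ q)); rewrite -frobD -ey h1 h0 ex; ring.
have eX : X ^+ q = mu * Y.
  apply: (mulfI (expf_neq0 q mu0)); rewrite -exprMn -eY frobK.
  by rewrite norm1_frob // mulKf.
have eu : (d * u) ^+ q = mu * u.
  rewrite exprMn (norm1_frob hd) /u exprMn exprVn !frobB (exprMn _ d') eX eY.
  rewrite (norm1_frob hd) (norm1_frob hd').
  by field; rewrite dd0 d0 d'0 mulN1r dd1.
exists (aff (x0 + u) (y0 + d * u)).
  by rewrite mem_baer_aff frobD h0 eu; apply/eqP; ring.
rewrite in_setI hl hm; apply/andP; split; apply/eqP; first by ring.
by rewrite ex ey /u; field.
Qed.

(** Two infinite points of slopes 1 and -1 together with two affine points
    joined by a line of a third slope. *)
Lemma baer_quadrangle mu c : mu \in norm1 ->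
  exists Q : {set ppoint F}, [&& Q \subset baer mu c, #|Q| == 4%N
    & [forall l : pline F, (#|Q :&: points_of l| <= 2)%N]].
Proof.
move=> hmu.
have [d hd] : exists d, d \in norm1 :\ 1 :\ - 1.
  apply/set0Pn; rewrite -card_gt0 card_norm1D2 ?norm1_1 //.
  by case: q q_gt2 => [|[|]].
rewrite !in_setD1 in hd; case/and3P: hd => dN1 d1 hd.
have [z] : exists z : F, z \in [set z | (z != 0) && (z ^+ q == mu * d * z)].
  apply/set0Pn; rewrite -card_gt0 card_hilbert90 ?norm1M //.
  by case: q q_gt2 => [|[|]].
rewrite inE => /andP[z0 /eqP ez].
pose O := aff 0 (c ^+ q); pose P := aff z (c ^+ q + d * z).
pose R := inf 1; pose S := inf (-1).
have OP : O != P.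
  by apply: contraNneq z0 => /(aff_inj N_unit)[<-].
have RS : R != S by rewrite (inj_eq (inf_inj N_unit)) norm1_neqN1.
have OR : O != R by apply: aff_neq_inf.
have OS : O != S by apply: aff_neq_inf.
have PR : P != R by apply: aff_neq_inf.
have PS : P != S by apply: aff_neq_inf.
exists [set O; P; R; S]; apply/and3P; split.
- apply/subsetP => T; rewrite !inE -!orbA => /or4P[] /eqP->; rewrite -?in_setU.
  + by rewrite mem_baer_aff frobK mulr0 add0r.
  + rewrite mem_baer_aff frobD frobK exprMn ez (norm1_frob hd).
    by apply/eqP; field; apply: norm1_neq0.
  + by rewrite mem_baer_inf norm1_1.
  + by rewrite mem_baer_inf norm1N ?norm1_1.
- have -> : [set O; P; R; S] = S |: (R |: (P |: [set O])).
    by apply/setP => T; rewrite !inE; do 4!case: (_ == _).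
  rewrite !cardsU1 cards1 !inE !negb_or (eq_sym S R) (eq_sym S P) (eq_sym S O).
  by rewrite (eq_sym R P) (eq_sym R O) (eq_sym P O) RS PS OS PR OR OP.
apply/forallP => l.
have sub2 (T U : ppoint F) : [set O; P; R; S] :&: points_of l \subset [set T; U] ->
    (#|[set O; P; R; S] :&: points_of l| <= 2)%N.
  by move/subset_leq_card/leq_trans; apply; rewrite cards2; case: (T != U).
have slope3 e : O \in points_of l -> P \in points_of l -> inf e \in points_of l ->
    e = d.
  move=> hO hP hI; have [hl _] := line_slope N_unit hO hI.
  move: hP; rewrite hl subr0 addrAC subrr add0r => /eqP /(mulIf z0).
  by move->.
have [h|h] := boolP ((O \in points_of l) && (P \in points_of l)).
  case/andP: h => hO hP; apply: (sub2 O P); apply/subsetP => T.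
  rewrite in_setI !in_setU !in_set1 -!orbA => /andP[/or4P[] /eqP->];
    rewrite ?eqxx ?orbT // => hT.
  + by rewrite (slope3 _ hO hP hT) eqxx in d1.
  + by rewrite (slope3 _ hO hP hT) eqxx in dN1.
have [k|k] := boolP ((R \in points_of l) && (S \in points_of l)).
  have hl : points_of l = linf F.
    by case/andP: k => hR hS; apply: (line_linf N_unit N_aff RS hR hS); apply: inf_linf.
  apply: (sub2 R S); apply/subsetP => T.
  rewrite in_setI !in_setU !in_set1 -!orbA hl => /andP[/or4P[] /eqP->];
    rewrite ?eqxx ?orbT // => hT.
  + by have := aff_linf N_unit N_aff 0 (c ^+ q); rewrite hT.
  + by have := aff_linf N_unit N_aff z (c ^+ q + d * z); rewrite hT.
(* Now l misses one of O, P and one of R, S. *)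
apply: (sub2 (if O \in points_of l then O else P)
  (if R \in points_of l then R else S)); apply/subsetP => T.
rewrite in_setI !in_setU !in_set1 -!orbA => /andP[/or4P[] /eqP-> hT];
  move: h k; rewrite hT /= ?andbT ?eqxx ?orbT //.
- by move/negPf->; rewrite eqxx.
- by move=> _ /negPf->; rewrite eqxx orbT.
Qed.

Lemma subplane_baer mu c : mu \in norm1 -> subplane q (baer mu c).
Proof.
move=> hmu; apply/and3P; split; last first.
- apply/forallP => l; apply/implyP; rewrite inE => /(baer_line hmu).
  case=> [->|[x0 [y0 [d [h0 hd hA hI]]]]].
    by rewrite linf_cap_baer card_inf_norm1.
  by rewrite (baer_cap_line hmu hd h0 hA hI).
- exact/existsP/baer_quadrangle.
have meet (l m : pline F) P : P \in baer mu c -> P \in points_of l ->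
    P \in points_of m ->
    [exists P in baer mu c, P \in points_of l :&: points_of m].
  by move=> hB hl hm; apply/exists_inP; exists P => //; rewrite in_setI hl.
apply/forallP => l; apply/implyP; rewrite inE => /(baer_line hmu) hl.
apply/forallP => m; apply/implyP; rewrite inE => /(baer_line hmu) hm.
apply/implyP => lm.
case: hl hm => [hl|[x0 [y0 [d [h0 hd lA lI]]]]] [hm|[x1 [y1 [d' [h1 hd' mA mI]]]]].
- by rewrite (points_linf_unique hl hm) eqxx in lm.
- by apply: (meet _ _ (inf d')) => //; rewrite ?mem_baer_inf // hl inf_linf.
- by apply: (meet _ _ (inf d)) => //; rewrite ?mem_baer_inf // hm inf_linf.
have [e|dd'] := eqVneq d d'.
  by apply: (meet _ _ (inf d)) => //; rewrite ?mem_baer_inf // e.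
have [P PB] := baer_meet hmu h0 hd lA lI h1 hd' mA mI dd'.
by rewrite in_setI => /andP[]; apply: meet.
Qed.

Section Subplane.

Variable B : {set ppoint F}.
Hypothesis B_sub : subplane q B.
Hypothesis B_inf : inf_norm1 \subset B.

Let B_line (l : pline F) : (1 < #|B :&: points_of l|)%N ->
  #|B :&: points_of l| = q.+1.
Proof.
case/and3P: B_sub => _ _ /forallP/(_ l)/implyP h hl.
by apply/eqP/h; rewrite inE.
Qed.

Let B_lineP (l : pline F) P Q : P != Q -> P \in B -> Q \in B ->
  P \in points_of l -> Q \in points_of l -> (1 < #|B :&: points_of l|)%N.
Proof.
by move=> PQ PB QB Pl Ql; apply/card_gt1P; exists P, Q; rewrite !in_setI PB QB.
Qed.

(** The line at infinity carries at least two points of B, hence exactly q + 1,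
    and that many are supplied by [inf_norm1]. *)
Lemma subplane_linf : B :&: linf F = inf_norm1.
Proof.
have [l hl] := linf_line N_unit N_aff.
apply/esym/eqP; rewrite eqEcard subsetI B_inf inf_norm1_linf card_inf_norm1 /=.
have ne : inf 1 != inf (-1) by rewrite (inj_eq (inf_inj N_unit)) norm1_neqN1.
rewrite -hl B_line //; apply: (B_lineP ne); rewrite ?hl ?inf_linf //.
  by rewrite (subsetP B_inf) // mem_inf_norm1 norm1_1.
by rewrite (subsetP B_inf) // mem_inf_norm1 norm1N ?norm1_1.
Qed.

Lemma subplane_affine : exists x y, aff x y \in B.
Proof.
case/and3P: B_sub => _ /existsP[Q /and3P[QB /eqP Q4 /forallP Ql]] _.
have [l hl] := linf_line N_unit N_aff.
have : Q :\: linf F != set0.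
  rewrite -card_gt0 -hl -(ltn_add2l #|Q :&: points_of l|) addn0 cardsID Q4.
  exact: leq_ltn_trans (Ql l) _.
case/set0Pn => P; rewrite in_setD => /andP[hP PQ].
have [x [y e]] := aff_surj N_unit N_aff hP.
by exists x, y; rewrite -e (subsetP QB).
Qed.

(** The line joining two affine points of B and the line at infinity are both
    lines of the subplane, so they meet in a point of B. *)
Lemma subplane_chord x0 y0 x1 y1 : aff x0 y0 \in B -> aff x1 y1 \in B ->
  (x1, y1) != (x0, y0) -> x1 != x0 /\ (y1 - y0) / (x1 - x0) \in norm1.
Proof.
move=> h0 h1 ne.
have PQ : aff x1 y1 != aff x0 y0.
  by apply: contraNneq ne => /(aff_inj N_unit)[-> ->].
have [l [l1 l0]] := line_exists PQ.
have [m hm] := linf_line N_unit N_aff.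
have lm : l != m.
  apply: contraTneq l0 => ->; rewrite hm; exact: aff_linf.
have hl := B_lineP PQ h1 h0 l1 l0.
have Bm : (1 < #|B :&: points_of m|)%N.
  by rewrite hm subplane_linf card_inf_norm1 ltnS q_gt0.
case/and3P: B_sub => /forallP/(_ l)/implyP; rewrite inE => /(_ hl).
move=> /forallP/(_ m)/implyP; rewrite inE => /(_ Bm)/implyP/(_ lm).
case/exists_inP => P PB; rewrite in_setI hm => /andP[Pl Pinf] _ _.
have : P \in inf_norm1 by rewrite -subplane_linf in_setI PB.
case/imsetP => d hd eP; rewrite eP in Pl.
have [hA _] := line_slope N_unit l0 Pl.
move: l1; rewrite hA => /eqP e.
have x10 : x1 != x0.
  apply: contraNneq ne => xx; move: e; rewrite xx subrr mulr0 => /eqP.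
  by rewrite subr_eq0 => /eqP->.
by split=> //; rewrite e mulfK // subr_eq0.
Qed.

(** Besides its infinite point, the line of slope d through a point of B carries
    q of the q + 1 points that B has on each of its lines. *)
Lemma subplane_line x0 y0 d : aff x0 y0 \in B -> d \in norm1 ->
  #|[set z : F | aff (x0 + z) (y0 + d * z) \in B]| = q.
Proof.
move=> h0 hd; have ne := aff_neq_inf N_unit N_aff x0 y0 d.
have [l [l0 lI]] := line_exists ne; have [hA hI] := line_slope N_unit l0 lI.
have dB : inf d \in B by rewrite (subsetP B_inf) // mem_inf_norm1.
have := B_line (B_lineP ne h0 dB l0 lI).
rewrite (cardsD1 (inf d)) in_setI dB lI add1n => -[<-].
pose f z := aff (x0 + z) (y0 + d * z).
have finj : injective f by move=> z z' /(aff_inj N_unit)[/addrI].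
rewrite -(card_imset _ finj); apply: eq_card => P.
apply/imsetP/idP => [[z]|].
  rewrite inE => hz ->; rewrite in_setD1 (aff_neq_inf N_unit N_aff) in_setI hz hA.
  by apply/eqP; ring.
rewrite in_setD1 in_setI => /and3P[PI PB Pl].
have Pinf : P \notin linf F.
  apply/negP => Pinf.
  have : P \in inf_norm1 by rewrite -subplane_linf in_setI PB.
  case/imsetP => d' _ eP; move: Pl PI; rewrite eP hI => /eqP->.
  by rewrite eqxx.
have [x [y e]] := aff_surj N_unit N_aff Pinf.
move: Pl; rewrite e hA => /eqP exy.
have ef : aff x y = f (x - x0) by rewrite /f -exy !subrKC.
by exists (x - x0); rewrite ?inE // -/(f _) -ef -e.
Qed.

(** The two points and (x0, y0) form a triangle of which all three sides have
    slope of norm 1. Taking q-th powers of the relation between the sides shows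
    that (Delta y)^q / Delta x is the same on the two sides through (x0, y0). *)
Lemma subplane_ratio x0 y0 d z d' z' : z != 0 -> z' != 0 -> d != d' ->
    d \in norm1 -> d' \in norm1 ->
    aff (x0 + z) (y0 + d * z) \in B -> aff (x0 + z') (y0 + d' * z') \in B ->
  (d * z) ^+ q / z = (d' * z') ^+ q / z'.
Proof.
move=> z0 z'0 dd' hd hd' h h'.
have d0 := norm1_neq0 hd; have d'0 := norm1_neq0 hd'.
have ne : (x0 + z', y0 + d' * z') != (x0 + z, y0 + d * z).
  rewrite xpair_eqE (inj_eq (addrI _)) (inj_eq (addrI _)).
  apply: contraNN dd' => /andP[/eqP-> /eqP/(mulIf z0)->]; exact: eqxx.
have [] := subplane_chord h h' ne.
rewrite (inj_eq (addrI _)) => zz.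
have zz0 : z' - z != 0 by rewrite subr_eq0.
have -> : x0 + z' - (x0 + z) = z' - z by ring.
have -> : y0 + d' * z' - (y0 + d * z) = d' * z' - d * z by ring.
set e := _ / _ => he; have e0 := norm1_neq0 he.
have E : d' * z' - d * z = e * (z' - z) by rewrite /e divfK.
clearbody e; have E' := congr1 (fun x => x ^+ q) E.
rewrite frobB !exprMn frobB (norm1_frob hd) (norm1_frob hd') in E'.
rewrite (norm1_frob he) in E'; rewrite !exprMn (norm1_frob hd) (norm1_frob hd').
(* e is the slope of the third side; it differs from d as d and d' differ. *)
have k0 : z * (e - d) != 0.
  rewrite mulf_neq0 // subr_eq0; apply: contraNneq dd' => ed.
  have : z' * (e - d') = 0.
    have -> : z' * (e - d') = e * (z' - z) - (d' * z' - e * z) by ring.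
    by rewrite [in X in _ - X]ed E subrr.
  by move/eqP; rewrite mulf_eq0 (negPf z'0) subr_eq0 ed.
have E1 : z' * (e - d') = z * (e - d).
  have -> : z' * (e - d') = e * (z' - z) - (d' * z' - d * z) + z * (e - d) by ring.
  by rewrite E subrr add0r.
apply: (mulIf k0); rewrite -{2}E1.
have -> : d^-1 * z ^+ q / z * (z * (e - d)) = (d^-1 - e^-1) * z ^+ q * e.
  by field; rewrite d0 z0 e0.
have -> : d'^-1 * z' ^+ q / z' * (z' * (e - d')) = (d'^-1 - e^-1) * z' ^+ q * e.
  by field; rewrite d'0 z'0 e0.
congr (_ * e); apply/esym/eqP; rewrite -subr_eq0.
have -> : (d'^-1 - e^-1) * z' ^+ q - (d^-1 - e^-1) * z ^+ q
  = (d'^-1 * z' ^+ q - d^-1 * z ^+ q) - e^-1 * (z' ^+ q - z ^+ q) by ring.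
by rewrite E' subrr.
Qed.

Lemma subplane_point x0 y0 d : aff x0 y0 \in B -> d \in norm1 ->
  exists2 z, z != 0 & aff (x0 + z) (y0 + d * z) \in B.
Proof.
move=> h0 hd; have := subplane_line h0 hd.
rewrite (cardsD1 0) inE addr0 mulr0 addr0 h0 add1n => e.
have : [set z | aff (x0 + z) (y0 + d * z) \in B] :\ 0 != set0.
  by rewrite -card_gt0 -ltnS e; apply: leq_trans q_gt2.
by case/set0Pn => z; rewrite !inE => /andP[z0 hz]; exists z.
Qed.

(** By [subplane_ratio] the quotient (Delta y)^q / Delta x from a fixed point of
    B is the same for any two points of B in different directions, and
    comparing with two auxiliary points, in the directions 1 and -1, shows that
    it is a constant mu. So B is contained in a new line, and equality
    follows by counting on each line through the fixed point. *)
Lemma subplane_eq_baer : exists mu c, mu \in norm1 /\ B = baer mu c.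
Proof.
have [x0 [y0 h0]] := subplane_affine.
have [z1 z10 h1] := subplane_point h0 norm1_1.
have [z2 z20 h2] := subplane_point h0 (norm1N norm1_1).
pose mu := (1 * z1) ^+ q / z1.
have hmu : mu \in norm1 by rewrite /mu mul1r norm1_frob_div.
have ratio d z : d \in norm1 -> z != 0 -> aff (x0 + z) (y0 + d * z) \in B ->
    (d * z) ^+ q / z = mu.
  move=> hd z0 hz; have [e|d1] := eqVneq d 1; last first.
    exact: (subplane_ratio z0 z10 d1 hd norm1_1 hz h1).
  have ratio2 z' : z' != 0 -> aff (x0 + z') (y0 + 1 * z') \in B ->
      (1 * z') ^+ q / z' = (-1 * z2) ^+ q / z2.
    move=> z'0 hz'.
    exact: (subplane_ratio z'0 z20 norm1_neqN1 norm1_1 (norm1N norm1_1) hz' h2).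
  by rewrite e in hz *; rewrite /mu !ratio2.
clearbody mu; have line d z : d \in norm1 ->
    (aff (x0 + z) (y0 + d * z) \in B) = (z ^+ q == mu * d * z).
  move=> hd; have d0 := norm1_neq0 hd.
  suff /setP/(_ z) : [set z | aff (x0 + z) (y0 + d * z) \in B]
      = [set z | z ^+ q == mu * d * z] by rewrite !inE.
  apply/eqP; rewrite eqEcard subplane_line // card_frob_eigen ?norm1M //.
  rewrite leqnn andbT; apply/subsetP => w; rewrite !inE.
  have [->|w0] := eqVneq w 0; first by rewrite frob0 !mulr0.
  move=> hw; rewrite -(ratio d w) // exprMn (norm1_frob hd); apply/eqP.
  by field; rewrite w0 d0.
exists mu, (y0 ^+ q - mu * x0); split=> //; apply/setP => P.
have [hP|hP] := boolP (P \in linf F).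
  have := congr1 (fun A : {set ppoint F} => P \in A) subplane_linf.
  rewrite -(linf_cap_baer mu (y0 ^+ q - mu * x0)).
  by rewrite !in_setI hP !andbT.
have [x [y ->]] := aff_surj N_unit N_aff hP; rewrite mem_baer_aff.
have [[-> ->]|ne] := eqVneq (x, y) (x0, y0); first by rewrite h0 subrKC eqxx.
have e0 : y0 ^+ q = mu * x0 + (y0 ^+ q - mu * x0) by rewrite subrKC.
have main : x != x0 -> (y - y0) / (x - x0) \in norm1 ->
    (aff x y \in B) = (y ^+ q == mu * x + (y0 ^+ q - mu * x0)).
  move=> xx0 hd; set d := _ / _ in hd; pose z := x - x0.
  have z0 : z != 0 by rewrite subr_eq0.
  have d0 := norm1_neq0 hd.
  have ex : x = x0 + z by rewrite subrKC.
  have ey : y = y0 + d * z by rewrite divfK // subrKC.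
  rewrite ex ey line // frobD exprMn (norm1_frob hd).
  rewrite -(inj_eq (mulfI (invr_neq0 d0))) -[RHS](inj_eq (addIr (- y0 ^+ q))).
  by congr (_ == _); field.
apply/idP/idP => h.
  by have [xx hd] := subplane_chord h0 h ne; rewrite -main.
by have [xx hd] := new_line_slope hmu e0 (eqP h) ne; rewrite main.
Qed.

End Subplane.

Lemma new_lines_inf_norm1 : new_lines q inf_norm1 =
  [set new_line y.1 y.2 | y in [set y : F * F | y.1 \in norm1]].
Proof.
apply/setP => L; apply/imsetP/imsetP => [[B]|[[mu c]]].
  rewrite inE => /andP[hB hD] ->.
  have [mu [c [hmu ->]]] := subplane_eq_baer hB hD.
  by exists (mu, c); [rewrite in_set | rewrite baerD_linf].
rewrite in_set /= => hmu ->; exists (baer mu c); last by rewrite baerD_linf.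
by rewrite inE subplane_baer // subsetUl.
Qed.

Lemma new_line_inj : injective (fun y : F * F => new_line y.1 y.2).
Proof.
move=> [mu c] [mu' c'] /= e.
have key x : mu * x + c = mu' * x + c'.
  have : aff x ((mu * x + c) ^+ q) \in new_line mu' c'.
    by rewrite -e mem_new_line frobK.
  by rewrite mem_new_line frobK => /eqP.
have ec : c = c' by have := key 0; rewrite !mulr0 !add0r.
by have := key 1; rewrite ec !mulr1 => /addIr->.
Qed.

Section AffineParabola.

Variables (al be ga : F) (K : {set ppoint F}).
Hypothesis al0 : al != 0.
Hypothesis K_aff : forall x y, (aff x y \in K) = (x == quad al be ga y).

Lemma card_new_line_parabola mu c :
  #|new_line mu c :&: K| = #|hits al be ga mu c|.
Proof.
pose f t := aff (quad al be ga t) t.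
have finj : injective f by move=> t t' /(aff_inj N_unit)[].
rewrite -(card_imset _ finj); apply: eq_card => P; rewrite in_setI.
apply/andP/imsetP => [[/imsetP[[x y]]]|[t ht ->]].
  rewrite in_set /= => hxy ->; rewrite K_aff => /eqP e.
  by exists y; rewrite ?/f -?e // in_set -e.
by rewrite mem_new_line K_aff eqxx; move: ht; rewrite in_set => ->.
Qed.

(** Three common points would make the linear form of the line, restricted to
    the parabola, a quadratic polynomial with three roots, hence zero. *)
Lemma card_old_line_parabola L : L \in old_lines inf_norm1 -> (#|L :&: K| <= 2)%N.
Proof.
case/imsetP => l _ ->; rewrite leqNgt; apply/card_gt2P.
have on P : P \in (points_of l :\: linf F) :&: K ->
    exists2 t, P = aff (quad al be ga t) t & P \in points_of l.
  rewrite in_setI in_setD => /andP[/andP[hP Pl]].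
  have [x [y e]] := aff_surj N_unit N_aff hP.
  by rewrite e K_aff => /eqP ex; exists y; rewrite -?ex // -e.
case=> [P [Q [R [[/on[r -> hr] /on[s -> hs] /on[t -> ht]]]]]].
case=> rs st tr.
have [a [b [ab hl _]]] := line_affine N_unit hr.
have rs' : s != r by apply: contraNneq rs => ->.
have st' : s != t by apply: contraNneq st => ->.
have tr' : t != r by apply: contraNneq tr => ->.
have chord u : u != r -> aff (quad al be ga u) u \in points_of l ->
    a * slope al be u r + b = 0.
  move=> ur; rewrite hl quadB => /eqP e.
  have ur0 : u - r != 0 by rewrite subr_eq0.
  by apply: (mulIf ur0); rewrite mul0r -[RHS]e; ring.
have es := chord s rs' hs; have et := chord t tr' ht.
have /eqP : a * (al * (s - t)) = 0.
  by rewrite -[RHS](subrr 0) -{1}es -et /slope; ring.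
rewrite !mulf_eq0 (negPf al0) subr_eq0 (negPf st') !orbF => /eqP a0.
by move: ab es; rewrite a0 eqxx mul0r add0r /= => /eqP.
Qed.

Lemma card_hall_lines_parabola k : (2 < k)%N ->
  #|[set L in hall_lines q inf_norm1 | #|L :&: K| == k]|
  = #|secants al be ga k|.
Proof.
move=> k2; rewrite -(card_imset _ new_line_inj); apply: eq_card => L.
rewrite in_set /hall_lines in_setU new_lines_inf_norm1.
apply/andP/imsetP => [[/orP[/card_old_line_parabola hL|/imsetP[[mu c]]]]|].
- by move/eqP=> e; rewrite e leqNgt k2 in hL.
- rewrite in_set /= => hmu ->; rewrite card_new_line_parabola => hk.
  by exists (mu, c); rewrite // in_set hmu.
case=> [[mu c]]; rewrite in_set => /andP[hmu hk] ->.
rewrite card_new_line_parabola hk; split=> //; apply/orP; right.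
by apply/imsetP; exists (mu, c); rewrite // in_set.
Qed.

End AffineParabola.

End BaerSubplanes.

(** * Coordinates adapted to a derivation set and a parabola *)

Section Frame.

Variables (M : 'M[F]_2) (kp : 'rV[F]_2).
Hypothesis M_unit : M \in unitmx.
Hypothesis kp_gen : kp 0 0 * kp 0 1 ^+ q != kp 0 1 * kp 0 0 ^+ q.

Let kb : 'rV[F]_2 := \row_j (kp 0 j ^+ q).

Lemma row2P (v w : 'rV[F]_2) : v 0 0 = w 0 0 -> v 0 1 = w 0 1 -> v = w.
Proof.
move=> h0 h1; apply/rowP => -[[|[|//]] hj].
  by rewrite (_ : Ordinal hj = 0) //; apply: val_inj.
by rewrite (_ : Ordinal hj = 1) //; apply: val_inj.
Qed.

(** Cramer's rule: the determinant of kp and its conjugate kb is nonzero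
    by [kp_gen]. *)
Lemma conj_basis (v : 'rV[F]_2) : exists x y, v = x *: kp + y *: kb.
Proof.
have d0 : kp 0 0 * kp 0 1 ^+ q - kp 0 1 * kp 0 0 ^+ q != 0 by rewrite subr_eq0.
set d := _ - _ in d0.
exists ((v 0 0 * kp 0 1 ^+ q - v 0 1 * kp 0 0 ^+ q) / d),
  ((kp 0 0 * v 0 1 - kp 0 1 * v 0 0) / d).
by apply: row2P; rewrite !mxE /d; field.
Qed.

Lemma conj_free x y x' y' : x *: kp + y *: kb = x' *: kp + y' *: kb ->
  x = x' /\ y = y'.
Proof.
move=> /rowP e; have := e 0; have := e 1; rewrite !mxE => e1 e0.
have d0 : kp 0 0 * kp 0 1 ^+ q - kp 0 1 * kp 0 0 ^+ q != 0 by rewrite subr_eq0.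
split; apply: (mulIf d0); apply/eqP; rewrite -subr_eq0.
  have -> : x * (kp 0 0 * kp 0 1 ^+ q - kp 0 1 * kp 0 0 ^+ q)
     - x' * (kp 0 0 * kp 0 1 ^+ q - kp 0 1 * kp 0 0 ^+ q)
     = kp 0 1 ^+ q * ((x * kp 0 0 + y * kp 0 0 ^+ q) - (x' * kp 0 0 + y' * kp 0 0 ^+ q))
     - kp 0 0 ^+ q * ((x * kp 0 1 + y * kp 0 1 ^+ q) - (x' * kp 0 1 + y' * kp 0 1 ^+ q)) by ring.
  by rewrite e0 e1 !subrr !mulr0 subr0.
have -> : y * (kp 0 0 * kp 0 1 ^+ q - kp 0 1 * kp 0 0 ^+ q)
     - y' * (kp 0 0 * kp 0 1 ^+ q - kp 0 1 * kp 0 0 ^+ q)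
     = kp 0 0 * ((x * kp 0 1 + y * kp 0 1 ^+ q) - (x' * kp 0 1 + y' * kp 0 1 ^+ q))
     - kp 0 1 * ((x * kp 0 0 + y * kp 0 0 ^+ q) - (x' * kp 0 0 + y' * kp 0 0 ^+ q)) by ring.
by rewrite e0 e1 !subrr !mulr0 subr0.
Qed.

(** The first two vectors are kp and its conjugate with respect to the Baer
    subline given by M, placed on the line at infinity. *)
Definition frame : 'M[F]_3 := \matrix_i
  [:: row_mx (kp *m M) 0 : 'rV_(2 + 1); row_mx (kb *m M) 0; row_mx 0 1%:M]`_i.

Lemma frameE x y w : vec3 x y w *m frame
  = row_mx ((x *: kp + y *: kb) *m M) w%:M :> 'rV_(2 + 1).
Proof.
rewrite mulmx_sum_row !big_ord_recl big_ord0 !rowK !mxE /= addr0.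
rewrite -[LHS]/(x *: row_mx (kp *m M) 0 +
  (y *: row_mx (kb *m M) 0 + w *: row_mx 0 1%:M) : 'rV_(2 + 1)).
rewrite !scale_row_mx !add_row_mx !scaler0 !add0r addr0 mulmxDl -!scalemxAl.
by rewrite scale_scalar_mx mulr1.
Qed.

Lemma frame_unit : frame \in unitmx.
Proof.
rewrite -row_free_unit; apply: inj_row_free => v.
have [x [y [w ->]]] := vec3_surj v; rewrite frameE => e.
have [h1 h2] := @eq_row_mx _ 1 2 1 _ _ _ _ (etrans e (esym (row_mx0 _ 1 2 1))).
have : x *: kp + y *: kb = 0 *: kp + 0 *: kb.
  by rewrite -[LHS](mulmxK M_unit) h1 mul0mx !scale0r addr0.
case/conj_free=> -> ->; move/matrixP/(_ 0 0): h2; rewrite !mxE eqxx mulr1n => ->.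
by rewrite -vec3_0.
Qed.

Lemma frame_aff : col ord_max frame = delta_mx ord_max 0.
Proof.
apply/colP => i; rewrite !mxE /=.
have -> : ord_max = rshift 2 0 :> 'I_(2 + 1) by apply: val_inj.
by case: i => [[|[|[|//]]] hi] /=; rewrite row_mxEr !mxE.
Qed.

Lemma frame_scale z : z != 0 ->
  row_mx ((z *: kp + z ^+ q *: kb) *m M) (0 : 'rV_1)
  = z *: (vec3 1 (z ^+ q / z) 0 *m frame).
Proof.
move=> z0; rewrite scalemxAl vec3Z frameE mulr1 mulr0 mulrCA divff // mulr1.
by rewrite raddf0.
Qed.

Lemma inf_frameP z (P : ppoint F) : z != 0 -> reflect (P = inf frame (z ^+ q / z))
  (val P == row_mx ((z *: kp + z ^+ q *: kb) *m M) (0 : 'rV_1))%MS.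
Proof.
move=> z0; rewrite frame_scale //.
have v0 : vec3 1 (z ^+ q / z) 0 *m frame != 0.
  by rewrite (vec3N_neq0 frame_unit) oner_eq0.
have /andP[/eqP gP _] := valP P.
apply: (iffP eqmxP) => [e|->].
  apply: val_inj; rewrite val_span_point // -[LHS]gP; apply: eq_genmx.
  exact: eqmx_trans e (eqmx_scale _ z0).
rewrite val_span_point //.
exact: eqmx_trans (genmxE _) (eqmx_sym (eqmx_scale _ z0)).
Qed.

(** A vector x kp + y kb has all its coordinates in GF(q) exactly when it is
    fixed by conjugation, that is, when y = x^q. Its slope is then x^(q-1), and
    by Hilbert 90 all elements of norm 1 are of this form. *)
Lemma baer_subline_frame : baer_subline q M = inf_norm1 frame.
Proof.
apply/setP => P; rewrite inE; apply/existsP/imsetP.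
  case=> v /and3P[v0 /forallP vq hP]; have [x [y ev]] := conj_basis v.
  have [ex ey] : y ^+ q = x /\ x ^+ q = y.
    apply: conj_free; rewrite -ev; apply/rowP => j.
    have := vq j; rewrite inE => /eqP <-.
    by rewrite ev !mxE frobD !exprMn frobK addrC.
  have x0 : x != 0.
    apply: contraNneq v0 => x0.
    by rewrite ev -ey x0 frob0 !scale0r addr0.
  exists (x ^+ q / x); first exact: norm1_frob_div.
  by apply/(inf_frameP P x0); rewrite ey -ev.
case=> d hd eP.
have [z] : exists z : F, z \in [set z | (z != 0) && (z ^+ q == d * z)].
  apply/set0Pn; rewrite -card_gt0 card_hilbert90 //.
  by case: q q_gt2 => [|[|]].
rewrite inE => /andP[z0 /eqP ez].
exists (z *: kp + z ^+ q *: kb); apply/and3P; split.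
- apply: contra_neq z0 => e.
  have : z *: kp + z ^+ q *: kb = 0 *: kp + 0 *: kb by rewrite e !scale0r addr0.
  by case/conj_free.
- apply/forallP => j; rewrite inE !mxE frobD !exprMn !frobK.
  by rewrite addrC.
by apply/(inf_frameP P z0); rewrite eP ez mulfK.
Qed.

End Frame.

(** If kp spans the infinite point of K, relative to M, then a proportionality
    between kp and its conjugate would make kp a multiple of a vector over
    GF(q) and put the point into D. So kp and its conjugate can serve as the
    first two vectors of the frame. *)
Lemma parabola_frame (D K : {set ppoint F}) :
    derivation_set q D -> parabola K ->
    (forall P, P \in K :&: linf F -> P \notin D) ->
  exists N al be ga, [/\ N \in unitmx, col ord_max N = delta_mx ord_max 0,
    D = inf_norm1 N, al != 0
    & forall x y, (aff N x y \in K) = (x == quad al be ga y)].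
Proof.
move=> [M M_unit eD] [hK /eqP/cards1P[P eP]] hKD.
have PD : P \notin D by apply: hKD; rewrite eP set11.
have Pinf : P \in linf F.
  by have : P \in K :&: linf F; [rewrite eP set11 | rewrite in_setI => /andP[]].
have [v v0 ePv] := span_point_surj P.
have [kp ev] : exists kp : 'rV[F]_2, v = row_mx (kp *m M) (0 : 'rV_1).
  exists (lsubmx (v : 'rV_(2 + 1)) *m invmx M); rewrite mulmxKV //.
  have r0 : @rsubmx _ 1 2 1 v = 0.
    apply/rowP => j; rewrite ord1 !mxE; move: Pinf.
    rewrite ePv linf_span // => /eqP <-.
    by congr (v _ _); apply: val_inj.
  by rewrite -r0 hsubmxK.
have kp_gen : kp 0 0 * kp 0 1 ^+ q != kp 0 1 * kp 0 0 ^+ q.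
  apply: contra PD => /eqP e; rewrite eD inE.
  have mem_subline (w : 'rV[F]_2) k : (forall j, w 0 j \in subGF F q) -> kp = k *: w ->
    [exists w : 'rV[F]_2, [&& w != 0, [forall i, w 0 i \in subGF F q]
       & (val P == row_mx (w *m M) (0 : 'rV_1))%MS]].
    move=> hw ek.
    have k0 : k != 0.
      by apply: contraNneq v0 => k0; rewrite ev ek k0 scale0r mul0mx row_mx0.
    apply/existsP; exists w; apply/and3P; split; last 1 first.
    - rewrite ePv val_span_point // ev ek -scalemxAl.
      have -> : row_mx (k *: (w *m M)) (0 : 'rV_1) = k *: row_mx (w *m M) 0.
        by rewrite scale_row_mx scaler0.
      exact/eqmxP/(eqmx_trans (genmxE _) (eqmx_scale _ k0)).
    - by apply: contraNneq v0 => w0; rewrite ev ek w0 scaler0 mul0mx row_mx0.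
    - exact/forallP.
  have [k0|k0] := eqVneq (kp 0 0) 0.
    apply: (mem_subline (\row_j (j == 1)%:R) (kp 0 1)).
      by move=> j; rewrite inE mxE; case: (j == 1); rewrite ?expr1n ?frob0.
    by apply: row2P; rewrite !mxE ?k0 ?mulr0 ?mulr1.
  apply: (mem_subline (\row_j (kp 0 j / kp 0 0)) (kp 0 0)).
    move=> j; rewrite inE mxE exprMn exprVn; apply/eqP.
    have kq0 : kp 0 0 ^+ q != 0 by rewrite expf_neq0.
    apply: (mulIf (mulf_neq0 k0 kq0)).
    have ej : kp 0 j ^+ q * kp 0 0 = kp 0 j * kp 0 0 ^+ q.
      case: j => [[|[|//]] hj]; first by rewrite (_ : Ordinal hj = 0) 1?mulrC //; apply: val_inj.
      by rewrite (_ : Ordinal hj = 1) -?e 1?mulrC //; apply: val_inj.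
    have -> : kp 0 j ^+ q / kp 0 0 ^+ q * (kp 0 0 * kp 0 0 ^+ q) = kp 0 j ^+ q * kp 0 0.
      by field.
    by rewrite ej; field.
  by apply/rowP => j; rewrite !mxE mulrC divfK.
pose N := frame M kp.
have N_unit := frame_unit M_unit kp_gen; have N_aff := frame_aff M kp.
have Kinf : K :&: linf F = [set inf N 0].
  rewrite eP; congr [set _]; rewrite ePv /inf /hpoint frameE scale1r scale0r addr0.
  by rewrite raddf0 -ev.
have [al [be [ga [al0 hal]]]] := parabola_equation N_unit N_aff hK Kinf.
exists N, al, be, ga; split=> //.
by rewrite eD (baer_subline_frame M_unit kp_gen).
Qed.

End QuadraticExtension.

Theorem theorem6p4 (q p e : nat) (hp : prime p) (he : (0 < e)%N)
    (hq : q = (p ^ e)%N) (hodd : odd q)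
    (F : finFieldType) (hF : #|F| = (q ^ 2)%N)
    (D : {set ppoint F}) (hD : derivation_set q D)
    (K : {set ppoint F}) (hK : parabola K)
    (hKD : forall P : ppoint F, P \in K :&: linf F -> P \notin D) :
  (#|[set L in hall_lines q D | #|L :&: K| == 3%N]|%:R
     = (q%:R ^+ 2 - 1) / 2 :> rat)
  /\ (#|[set L in hall_lines q D | #|L :&: K| == 4%N]|%:R
     = (q%:R - 3) * (q%:R ^+ 2 - 1) / 24 :> rat).
Proof.
have q_gt2 : (2 < q)%N.
  have q_gt1 : (1 < q)%N by rewrite hq -(exp1n e) ltn_exp2r ?prime_gt1.
  by rewrite ltn_neqAle q_gt1 andbT; apply: contraTneq hodd => <-.
have pF : p \in [pchar F].
  by apply: (@card_finPcharP _ _ (e * 2)); rewrite // hF hq expnM.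
have frobD (x y : F) : (x + y) ^+ q = x ^+ q + y ^+ q.
  by apply: exprDn_pchar; rewrite hq pnatX pnatE ?pF.
have two_neq0 : 2 != 0 :> F.
  rewrite -(dvdn_pcharf pF) dvdn_prime2 //; apply: contraTneq hodd => p2.
  by rewrite hq p2 oddX orbF -lt0n he.
have [N [al [be [ga [N_unit N_aff -> al0 hKa]]]]] :=
  parabola_frame hF q_gt2 frobD hD hK hKD.
rewrite !(card_hall_lines_parabola hF q_gt2 frobD two_neq0 N_unit N_aff al0 hKa) //.
have := card_secants3 hF q_gt2 frobD two_neq0 be ga al0.
have := card_secants4 hF q_gt2 frobD two_neq0 be ga al0.
set n4 := #|_|; set n3 := #|_| => h4 h3.
have eq1 : q.-1%:R = q%:R - 1 :> rat by rewrite -subn1 natrB // (ltn_trans _ q_gt2).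
have eq3 : (q - 3)%:R = q%:R - 3 :> rat by rewrite natrB.
have H3 := congr1 (fun n => n%:R : rat) h3.
have H4 := congr1 (fun n => n%:R : rat) h4.
rewrite /= !natrM -[q.+1%:R]natr1 eq1 ?eq3 in H3 H4.
split.
  by apply: (@mulIf _ 6); rewrite ?Num.Theory.pnatr_eq0 // H3; field.
by apply: (@mulIf _ 24); rewrite ?Num.Theory.pnatr_eq0 // H4; field.
Qed.
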